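(* Let $(\mathcal X_+,\mathcal X_0,\mathcal X_-)$ be a quasi Gelfand triple of Hilbert spaces. Then there exist two ``ordinary'' Gelfand triples $\mathcal X_+^1\subseteq \mathcal X_0^1\subseteq \mathcal X_-^1$ and $\mathcal X_+^2\subseteq \mathcal X_0^2\subseteq \mathcal X_-^2$ such that $$\mathcal X_+=\mathcal X_+^1\oplus \mathcal X_-^2,\qquad \mathcal X_0=\mathcal X_0^1\oplus \mathcal X_0^2,\qquad \mathcal X_-=\mathcal X_-^1\oplus \mathcal X_+^2 .$$
   Context: All spaces are complex; the anti-dual $X'$ of a Banach space $X$ is the space of continuous antilinear functionals on $X$. For Banach spaces $X,Y$ and a continuous sesquilinear form $\langle\cdot,\cdot\rangle_{Y,X}:Y\times X\to\mathbb C$ (linear in the first, antilinear in the second argument), put $\langle x,y\rangle_{X,Y}:=\overline{\langle y,x\rangle_{Y,X}}$. $(X,Y)$ is a complete dual pair if $Y\to X'$, $y\mapsto\langle y,\cdot\rangle_{Y,X}$ and $X\to Y'$, $x\mapsto\langle x,\cdot\rangle_{X,Y}$ are both isometric and bijective. A pre-quasi Gelfand triple $(\mathcal X_+,\mathcal X_0,\mathcal X_-)$ consists of a complete dual pair $(\mathcal X_+,\mathcal X_-)$, a Hilbert space $\mathcal X_0$ and linear maps $\iota_\pm:\operatorname{dom}\iota_\pm\subseteq\mathcal X_\pm\to\mathcal X_0$ that are densely defined, closed, injective and have dense range, with $\langle g,f\rangle_{\mathcal X_-,\mathcal X_+}=\langle\iota_-g,\iota_+f\rangle_{\mathcal X_0}$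 for all $f\in\operatorname{dom}\iota_+$, $g\in\operatorname{dom}\iota_-$. It is a quasi Gelfand triple if in addition $\operatorname{dom}\iota_+^*=\operatorname{ran}\iota_-$, where $\operatorname{dom}\iota_+^*$ is the set of $h\in\mathcal X_0$ for which $\operatorname{dom}\iota_+\ni f\mapsto\langle h,\iota_+f\rangle_{\mathcal X_0}$ is continuous with respect to $\|\cdot\|_{\mathcal X_+}$. It is ``of Hilbert spaces'' if $\mathcal X_+$ and $\mathcal X_-$ are Hilbert spaces. Convention: $\operatorname{dom}\iota_+$ is identified with $\operatorname{ran}\iota_+$ via $\iota_+$ and denoted $D_+$, and $\operatorname{dom}\iota_-$ is identified with $\operatorname{ran}\iota_-$ via $\iota_-$ and denoted $D_-$; embeddings between subspaces of $\mathcal X_\pm$ and $\mathcal X_0$ are understood via $\iota_\pm$ and $\iota_\pm^{-1}$. An ``ordinary'' Gelfand triple, written $\mathcal Y_+\subseteq\mathcal Y_0\subseteq\mathcal Y_-$, is a quasi Gelfand triple $(\mathcal Y_+,\mathcal Y_0,\mathcal Y_-)$ whose embedding of $\mathcal Y_+$ into $\mathcal Y_0$ is continuous (hence everywhere defined); then $\mathcal Y_0$ is continuously and densely embedded in $\mathcal Y_-$. The symbol $\oplus$ denotes the (orthogonal) direct sum of Hilbert spaces. *)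

(* Defs.v *)
From HB Require Import structures.
From mathcomp Require Import all_boot all_order all_algebra.
From mathcomp Require Import sesquilinear complex.
From mathcomp Require Import all_classical all_reals all_analysis.

Set Implicit Arguments.
Unset Strict Implicit.
Unset Printing Implicit Defensive.

Import Order.TTheory GRing.Theory Num.Theory.
Import numFieldNormedType.Exports.

Local Open Scope classical_set_scope.
Local Open Scope ring_scope.

(* The complex numbers, with their field, order (x <= y iff y - x is a
   nonnegative real) and norm topology; the norm of a normed space over [Cplx R]
   takes values in the nonnegative reals of [Cplx R]. *)
Definition Cplx (R : realType) : numClosedFieldType := R[i].

HB.mixin Record NormedModule_hasInnerProduct (R : realType) X
    of NormedModule (Cplx R) X := {
  hdot : {dot X for @Num.conj (Cplx R)};
  hdotxx : forall x : X, hdot x x = `|x| ^+ 2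
}.

#[short(type="hilbertType")]
HB.structure Definition Hilbert (R : realType) :=
  {X of NormedModule_hasInnerProduct R X & CompleteNormedModule (Cplx R) X}.

Section AntiDual.
Context {R : realType} {X : normedModType (Cplx R)}.

Definition antidual : set (X -> Cplx R) :=
  [set phi | (forall a u v, phi (a *: u + v) = a^* * phi u + phi v) /\
             continuous phi].

Definition antidual_norm (phi : X -> Cplx R) : R :=
  sup [set complex.Re `|phi x| | x in [set x : X | `|x| <= 1]].

End AntiDual.

Arguments antidual {R} X.

Definition isometric_onto_antidual (R : realType) (X Y : normedModType (Cplx R))
    (B : Y -> X -> Cplx R) : Prop :=
  (forall y, (antidual_norm (B y))%:C%C = `|y|) /\
  set_bij [set: Y] (antidual X) B.

Notation sesquilinear_form R Y X :=
  {bilinear Y -> X -> Cplx R | *%R & (@Num.conj (Cplx R)) \; *%R}.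

Definition complete_dual_pair (R : realType)
    (X Y : completeNormedModType (Cplx R)) (B : sesquilinear_form R Y X) : Prop :=
  [/\ continuous (fun p : Y * X => B p.1 p.2),
      isometric_onto_antidual B &
      isometric_onto_antidual (fun (x : X) (y : Y) => (B y x)^*)].

(* Linear maps defined on a linear subspace; the values of [lop_fun] outside
   [lop_dom] carry no information. *)
Record linear_operator (R : realType) (X Y : normedModType (Cplx R)) :=
  LinearOperator {
    lop_dom : set X;
    lop_fun :> X -> Y;
    lop_dom0 : lop_dom 0;
    lop_domP : forall a u v, lop_dom u -> lop_dom v -> lop_dom (a *: u + v);
    lop_linear : forall a u v, lop_dom u -> lop_dom v ->
      lop_fun (a *: u + v) = a *: lop_fun u + lop_fun v
  }.

Section LinearOperator.
Context {R : realType} {X Y : normedModType (Cplx R)}.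
Implicit Type T : linear_operator X Y.

Definition lop_ran T : set Y := T @` lop_dom T.

Definition densely_defined T : Prop := dense (lop_dom T).

Definition closed_operator T : Prop :=
  closed [set p : X * Y | lop_dom T p.1 /\ p.2 = T p.1].

Definition embedding_operator T : Prop :=
  [/\ densely_defined T, closed_operator T,
      set_inj (lop_dom T) T & dense (lop_ran T)].

End LinearOperator.

Definition adjoint_dom (R : realType) (X : normedModType (Cplx R))
    (X0 : hilbertType R) (T : linear_operator X X0) : set X0 :=
  [set h | {within lop_dom T, continuous (fun f => hdot h (T f) : Cplx R)}].

Record pre_quasi_gelfand_triple (R : realType)
    (Xp : completeNormedModType (Cplx R)) (X0 : hilbertType R)
    (Xm : completeNormedModType (Cplx R)) := PreQuasiGelfandTriple {
  pairing : sesquilinear_form R Xm Xp;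
  iotap : linear_operator Xp X0;
  iotam : linear_operator Xm X0;
  pairing_dual : complete_dual_pair pairing;
  iotap_embedding : embedding_operator iotap;
  iotam_embedding : embedding_operator iotam;
  pairing_iota : forall f g, lop_dom iotap f -> lop_dom iotam g ->
    pairing g f = hdot (iotam g) (iotap f)
}.

Section GelfandTriple.
Context {R : realType} {Xp : completeNormedModType (Cplx R)}.
Context {X0 : hilbertType R} {Xm : completeNormedModType (Cplx R)}.
Implicit Type T : pre_quasi_gelfand_triple Xp X0 Xm.

Definition quasi_gelfand_triple T : Prop :=
  adjoint_dom (iotap T) = lop_ran (iotam T).

Definition gelfand_triple T : Prop :=
  quasi_gelfand_triple T /\ {within lop_dom (iotap T), continuous (iotap T)}.

End GelfandTriple.

(* [X] is the orthogonal direct sum of [Y] and [Z], viewed as (closed) subspaces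
   of [X] through the isometric inclusions [j] and [k]. *)
Definition orthogonal_sum (R : realType) (X Y Z : hilbertType R)
    (j : {linear Y -> X}) (k : {linear Z -> X}) : Prop :=
  [/\ forall y y', hdot (j y) (j y') = hdot y y',
      forall z z', hdot (k z) (k z') = hdot z z',
      forall y z, hdot (j y) (k z) = 0 &
      forall x, exists y z, x = j y + k z].

(* [S] is the restriction of [T] to the subspace [Y] of [X]; in particular [T]
   maps [lop_dom T] intersected with [Y] into the subspace [Y0] of [X0]. *)
Definition restricts_to (R : realType) (X X0 Y Y0 : normedModType (Cplx R))
    (j : Y -> X) (j0 : Y0 -> X0)
    (T : linear_operator X X0) (S : linear_operator Y Y0) : Prop :=
  (forall y, lop_dom S y <-> lop_dom T (j y)) /\
  (forall y, lop_dom S y -> T (j y) = j0 (S y)).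

(* Main.v *)
(* The idea is to split [Xp] along the sign of the quadratic form
   [|f|^2 - |iota_+ f|^2], without spectral theory for unbounded operators.  On the
   graph of [iota_+], a closed subspace of the Hilbert space [Xp (+) X0], this form is
   given by a self-adjoint contraction [J]: the compression of [(f, h) |-> (f, -h)].
   With [|J|] the square root of [J^2], the kernel of [|J| + J] and its orthogonal
   complement split the graph into two parts that are orthogonal both for the inner
   product and for the form, hence orthogonal in [Xp] and in [X0] separately.  On the
   first part [|iota_+ f| <= |f|], so its projection [A] to [Xp] is closed; on the
   second [|f| <= |iota_+ f|], so its projection [D] to [X0] is closed.  The triples
   are then [Xp1 = A], [Xm2 = A^perp], [X02 = D], [X01 = D^perp]; [Xm1] and [Xp2] are
   the annihilators of [A^perp] and [A] in [Xm], and [dom iota_+^* = ran iota_-]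
   makes [iota_-] split accordingly. *)

From HB Require Import structures.
Require Import Defs.
From mathcomp Require Import all_boot all_order all_algebra.
From mathcomp Require Import sesquilinear complex.
From mathcomp Require Import all_classical all_reals all_analysis.
From mathcomp Require Import ring lra.

Set Implicit Arguments.
Unset Strict Implicit.
Unset Printing Implicit Defensive.

Import Order.TTheory GRing.Theory Num.Theory.
Import numFieldNormedType.Exports.

Local Open Scope classical_set_scope.
Local Open Scope ring_scope.

(** * Hilbert spaces from an inner product *)

(** Positivity of the form at [form v v *: u - form u v *: v], divided by [form v v]. It is stated
    for a bare form because the triangle inequality of the norm rests on it. *)
Lemma dot_cauchy_schwarz (C : numClosedFieldType) (U : lmodType C)
  (form : {dot U for @Num.conj C}) u v :
  `|form u v| ^+ 2 <= form u u * form v v.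
Proof.
have [->|v0] := eqVneq v 0; first by rewrite !linear0r normr0 expr0n.
have vv : 0 < form v v by rewrite dnorm_gt0.
have := dnorm_ge0 form (form v v *: u - form u v *: v).
rewrite linearBl !linearBr /= !linearZl_LR !linearZr_LR /=.
rewrite [form v u](hermC form) /= mul1r.
rewrite (CrealP (ger0_real (ltW vv))).
set a := form u v; set n := form v v; set m := form u u.
have -> : n * (n * m) - a^* * (n * a) - (n * (a * a^*) - a^* * (a * n)) = n * (m * n - `|a|^+2).
  by rewrite normCK; ring.
by rewrite pmulr_rge0 // subr_ge0.
Qed.

(** Completeness is phrased with the squared distances [dotm (x - y) (x - y)], so that an instance
    can be given before any norm exists; the builder derives the norm as a square root. *)
HB.factory Record Lmodule_isHilbert (R : realType) M & GRing.Lmodule (Cplx R) M := {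
  dotm : {dot M for @Num.conj (Cplx R)};
  dotm_complete : forall F : set_system M, ProperFilter F ->
    (forall e, 0 < e -> exists x, F [set y | dotm (x - y) (x - y) < e]) ->
    exists l, forall e, 0 < e -> F [set y | dotm (l - y) (l - y) < e]
}.

HB.builders Context R M & Lmodule_isHilbert R M.

Let nrm (x : M) : Cplx R := sqrtC (dotm x x).

Lemma nrmD x y : nrm (x + y) <= nrm x + nrm y.
Proof.
have n0 z : 0 <= nrm z by rewrite sqrt_dnorm_ge0.
rewrite -ler_sqr ?nnegrE ?addr_ge0 // sqrrD !sqrtCK hnormD /= mul1r.
rewrite [X in _ <= X]addrAC lerD2l.
have h : `|dotm x y| <= nrm x * nrm y.
  rewrite -ler_sqr ?nnegrE ?mulr_ge0 ?n0 // exprMn !sqrtCK.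
  exact: dot_cauchy_schwarz.
rewrite -mulr_natr mulrC; apply: (le_trans _ (ler_wpM2l (ler0n _ 2) h)).
set z := dotm x y.
have -> : z + z^* = 2 * 'Re z.
  by rewrite ReE mulrCA divff ?mulr1 // pnatr_eq0.
apply: ler_wpM2l => //.
by apply: le_trans (leif_normC_Re_Creal z).1; exact: real_ler_norm (Creal_Re z).
Qed.


Lemma nrmZ (l : Cplx R) x : nrm (l *: x) = `|l| * nrm x.
Proof.
by rewrite /nrm dnormZ sqrtCM ?nnegrE ?exprn_ge0 ?dnorm_ge0 // sqrCK.
Qed.

Lemma nrm0_eq0 x : nrm x = 0 -> x = 0.
Proof. by move/eqP; rewrite sqrt_dnorm_eq0 => /eqP. Qed.

HB.instance Definition _ := Lmodule_isNormed.Build (Cplx R) M nrmD nrmZ nrm0_eq0.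

Lemma dotm_cvg (F : set_system M) : ProperFilter F -> cauchy F -> cvg F.
Proof.
move=> FF /cauchyP cF.
have nlt (x : M) (e : Cplx R) : 0 < e -> (`|x| < e) = (dotm x x < e ^+ 2).
  move=> e0; have -> : `|x| = nrm x by [].
  by rewrite -(sqrtCK (dotm x x)) ltr_sqr ?nnegrE ?sqrt_dnorm_ge0 ?(ltW e0).
have [|l hl] := dotm_complete FF.
  move=> e e0; have e1 : 0 < sqrtC e by rewrite sqrtC_gt0.
  have [x Fx] := cF _ e1; exists x.
  apply: filterS Fx => y; rewrite -ball_normE /= nlt // sqrtCK //.
apply/cvg_ex; exists l; apply/cvgrPdist_lt => e e0.
have := hl _ (exprn_gt0 2 e0); apply: filterS => y /=.
by rewrite nlt.
Qed.

HB.instance Definition _ := Uniform_isComplete.Build M dotm_cvg.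

Lemma dotm_norm (x : M) : dotm x x = `|x| ^+ 2.
Proof. by rewrite -[LHS]sqrtCK. Qed.

HB.instance Definition _ := NormedModule_hasInnerProduct.Build R M dotm_norm.

HB.end.

(** * Real-valued norms and sequences *)

Section RealNorm.
Variable R : realType.

(** Norms take values in [Cplx R], which is only partially ordered; this real-valued copy lives in
    an ordered field where linear arithmetic applies. *)
Definition rnorm (V : normedZmodType (Cplx R)) (x : V) : R := complex.Re `|x|.

Section Zmod.
Variable V : normedZmodType (Cplx R).
Implicit Types x y : V.

Lemma rnormE x : `|x| = (rnorm x)%:C%C.
Proof. by rewrite /rnorm RRe_real // normr_real. Qed.

Lemma rnorm_le x (e : R) : (`|x| <= e%:C%C) = (rnorm x <= e).
Proof. by rewrite rnormE lecR. Qed.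

Lemma rnorm_lt x (e : R) : (`|x| < e%:C%C) = (rnorm x < e).
Proof. by rewrite rnormE ltcR. Qed.

Lemma rnorm_ge0 x : 0 <= rnorm x.
Proof. by rewrite -ler0c -rnormE. Qed.

Lemma rnormD x y : rnorm (x + y) <= rnorm x + rnorm y.
Proof. by rewrite -rnorm_le rmorphD /= -!rnormE ler_normD. Qed.

Lemma rnormN x : rnorm (- x) = rnorm x.
Proof. by rewrite /rnorm normrN. Qed.

Lemma rnormB x y : rnorm (x - y) = rnorm (y - x).
Proof. by rewrite -rnormN opprB. Qed.

Lemma rnorm_tri z x y : rnorm (x - y) <= rnorm (x - z) + rnorm (z - y).
Proof. by apply: le_trans (rnormD _ _); rewrite addrA subrK. Qed.

Lemma rnorm0 : rnorm (0 : V) = 0.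
Proof. by rewrite /rnorm normr0. Qed.

Lemma rnorm_eq0 x : rnorm x = 0 -> x = 0.
Proof. by move=> h; apply: normr0_eq0; rewrite rnormE h. Qed.

End Zmod.

Lemma rnormM (a b : Cplx R) : rnorm (a * b) = rnorm a * rnorm b.
Proof. by apply: complexI; rewrite rmorphM /= -!rnormE normrM. Qed.

Lemma rnorm_conj (a : Cplx R) : rnorm a^* = rnorm a.
Proof. by rewrite /rnorm norm_conjC. Qed.

Lemma rnorm_real (r : R) : rnorm (r%:C%C : Cplx R) = `|r|.
Proof. by apply: complexI; rewrite -rnormE normc_def /= expr0n addr0 sqrtr_sqr. Qed.

Lemma Re_le_rnorm (a : Cplx R) : complex.Re a <= rnorm a.
Proof.
rewrite -lecR -rnormE normc_def lecR.
apply: le_trans (ler_norm _) _; rewrite -sqrtr_sqr.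
by apply: ler_wsqrtr; rewrite lerDl sqr_ge0.
Qed.

Lemma rnormZ (V : normedModType (Cplx R)) (a : Cplx R) (x : V) :
  rnorm (a *: x) = rnorm a * rnorm x.
Proof. by apply: complexI; rewrite rmorphM /= -!rnormE normrZ. Qed.

Lemma gt0_complex (e : Cplx R) : 0 < e -> exists2 r : R, 0 < r & e = r%:C%C.
Proof.
move=> e0; have eR : e \is Num.real by exact: gtr0_real.
by exists (complex.Re e); rewrite ?RRe_real // -ltcR RRe_real.
Qed.

(** The epsilon form of sequential convergence, equivalent to the filter one by [tends_cvg]; it
    keeps estimates in real arithmetic. *)
Definition tends (V : normedZmodType (Cplx R)) (u : nat -> V) (l : V) :=
  forall e : R, 0 < e -> exists N, forall n, (N <= n)%N -> rnorm (u n - l) < e.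

Lemma tends_cvg (V : normedModType (Cplx R)) (u : nat -> V) l :
  tends u l <-> u @ \oo --> l.
Proof.
split.
  move=> h; apply/cvgrPdist_lt => e /gt0_complex[r r0 ->].
  have [N hN] := h _ r0; exists N => // n /= nN.
  by rewrite distrC rnorm_lt; exact: hN.
move=> /cvgrPdist_lt h e e0.
have [|N _ hN] := h e%:C%C; first by rewrite ltcR.
by exists N => n nN; rewrite -rnorm_lt distrC; exact: hN.
Qed.

Lemma closed_tends2 (V W : normedModType (Cplx R)) (A : set (V * W)) u l v m :
  closed A -> (forall n, A (u n, v n)) -> tends u l -> tends v m -> A (l, m).
Proof.
move=> cA Au /tends_cvg ul /tends_cvg vm.
have h : (fun n => (u n, v n)) @ \oo --> (l, m) by exact: cvg_pair.
by apply: (@closed_cvg _ _ _ _ _ _ cA _ _ h); apply: nearW.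
Qed.

Lemma tends_const (V : normedZmodType (Cplx R)) (l : V) : tends (fun=> l) l.
Proof. by move=> e e0; exists 0 => n _; rewrite subrr rnorm0. Qed.

Lemma tends_lip (V W : normedZmodType (Cplx R)) (f : V -> W) (c : R) u l :
  (forall x y, rnorm (f x - f y) <= c * rnorm (x - y)) ->
  tends u l -> tends (f \o u) (f l).
Proof.
move=> fc ul e e0.
(* The constant [c] has no prescribed sign, and [|c| + 1] is a positive bound for it. *)
have c1 : 0 < `|c| + 1 by rewrite ltr_wpDl.
have [N hN] := ul (e / (`|c| + 1)) (divr_gt0 e0 c1).
exists N => n /hN; rewrite ltr_pdivlMr //= => h.
apply: le_lt_trans (fc _ _) _; apply: le_lt_trans h.
rewrite mulrC; apply: ler_wpM2l; rewrite ?rnorm_ge0 //.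
by apply: le_trans (ler_norm _) _; rewrite lerDl.
Qed.

Lemma tends_unique (V : normedZmodType (Cplx R)) (u : nat -> V) l m :
  tends u l -> tends u m -> l = m.
Proof.
move=> ul um; apply/subr0_eq/rnorm_eq0/eqP; rewrite eq_le rnorm_ge0 andbT.
apply/ler_addgt0Pr => e e0; rewrite add0r.
have e2 : 0 < e / 2 by rewrite divr_gt0.
have [N hN] := ul _ e2; have [M hM] := um _ e2.
have := hN (maxn N M) (leq_maxl _ _); have := hM (maxn N M) (leq_maxr _ _).
have := rnorm_tri (u (maxn N M)) l m; rewrite (rnormB l (u _)); lra.
Qed.

Lemma tends_dense (V : normedModType (Cplx R)) (A : set V) x :
  dense A -> exists2 u, forall n, A (u n) & tends u x.
Proof.
move=> dA.
have /choice[u hu] (n : nat) : exists y, A y /\ rnorm (y - x) < n.+1%:R^-1.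
  have n0 : 0 < (n.+1%:R^-1 : R)%:C%C by rewrite ltcR invr_gt0.
  have [|y []] := dA (ball x (n.+1%:R^-1 : R)%:C%C) _ (ball_open _ _).
    by exists x; exact: ballxx.
  by rewrite -ball_normE /= rnorm_lt rnormB => *; exists y.
exists u => [n|e e0]; first by have [] := hu n.
have [N _ hN] := near_infty_natSinv_lt (PosNum e0).
exists N => n nN; have [_ h] := hu n; apply: lt_trans h _.
exact: (hN n).
Qed.

Lemma dense_tends (V : normedModType (Cplx R)) (A : set V) :
  (forall x e, 0 < e -> exists2 y, A y & rnorm (y - x) < e) -> dense A.
Proof.
move=> h O [x Ox] oO.
have : nbhs x O by rewrite nbhsE; exists O.
move=> /nbhs_ballP[_ /= /gt0_complex[e e0 ->] eO].
have [y Ay yx] := h x e e0.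
exists y; split => //; apply: eO.
by rewrite -ball_normE /= rnorm_lt rnormB.
Qed.

Lemma within_lip (V W : normedModType (Cplx R)) (A : set V) (f : V -> W) (c : R) :
  (forall x y, A x -> A y -> rnorm (f x - f y) <= c * rnorm (x - y)) ->
  {within A, continuous f}.
Proof.
move=> fc; apply/subspace_continuousP => x Ax.
apply/cvgrPdist_lt => e /gt0_complex[r r0 ->].
have c1 : 0 < `|c| + 1 by rewrite ltr_wpDl.
have d0 : 0 < (r / (`|c| + 1))%:C%C by rewrite ltcR divr_gt0.
rewrite /within /= /prop_near1 !near_simpl; apply/nbhs_ballP; exists (r / (`|c| + 1))%:C%C => //= y.
rewrite -ball_normE /= !rnorm_lt ltr_pdivlMr // => h Ay.
apply: le_lt_trans (fc _ _ Ax Ay) _; apply: le_lt_trans h.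
rewrite mulrC; apply: ler_wpM2l; rewrite ?rnorm_ge0 //.
by apply: le_trans (ler_norm _) _; rewrite lerDl.
Qed.

End RealNorm.

(** * Inner products, completeness and the projection theorem *)

Section HilbertGeometry.
Variables (R : realType) (X : hilbertType R).
Implicit Types x y z : X.

Lemma hdotC x y : hdot x y = (hdot y x)^*.
Proof. by rewrite (hermC hdot) /= expr0 mul1r. Qed.

Lemma hdotZl (a : Cplx R) x y : hdot (a *: x) y = a * hdot x y.
Proof. exact: linearZl_LR. Qed.

Lemma hdotZr (a : Cplx R) x y : hdot x (a *: y) = a^* * hdot x y.
Proof. exact: linearZr_LR. Qed.

Lemma hdotDl x y z : hdot (x + y) z = hdot x z + hdot y z.
Proof. exact: linearDl. Qed.

Lemma hdotDr x y z : hdot z (x + y) = hdot z x + hdot z y.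
Proof. exact: linearDr. Qed.

Lemma hdotBl x y z : hdot (x - y) z = hdot x z - hdot y z.
Proof. exact: linearBl. Qed.

Lemma hdotBr x y z : hdot z (x - y) = hdot z x - hdot z y.
Proof. exact: linearBr. Qed.

Definition rdot x y : R := complex.Re (hdot x y).

Lemma rdotC x y : rdot x y = rdot y x.
Proof. by rewrite /rdot hdotC; case: (hdot y x). Qed.

Lemma rdotDl x y z : rdot (x + y) z = rdot x z + rdot y z.
Proof. by rewrite /rdot linearDl raddfD. Qed.

Lemma rdotNl x y : rdot (- x) y = - rdot x y.
Proof. by rewrite /rdot linearNl raddfN. Qed.

Lemma rdotBl x y z : rdot (x - y) z = rdot x z - rdot y z.
Proof. by rewrite rdotDl rdotNl. Qed.

Lemma rdotDr x y z : rdot z (x + y) = rdot z x + rdot z y.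
Proof. by rewrite !(rdotC z) rdotDl. Qed.

Lemma rdotNr x y : rdot y (- x) = - rdot y x.
Proof. by rewrite !(rdotC y) rdotNl. Qed.

Lemma rdotBr x y z : rdot z (x - y) = rdot z x - rdot z y.
Proof. by rewrite rdotDr rdotNr. Qed.

Lemma rdotZl (r : R) x y : rdot (r%:C%C *: x) y = r * rdot x y.
Proof. by rewrite /rdot hdotZl; case: (hdot x y) => a b /=; rewrite mul0r subr0. Qed.

Lemma rdotZr (r : R) x y : rdot x (r%:C%C *: y) = r * rdot x y.
Proof. by rewrite rdotC rdotZl rdotC. Qed.

Lemma rdotxx x : rdot x x = rnorm x ^+ 2.
Proof. by apply: complexI; rewrite /rdot hdotxx rmorphXn /= -rnormE RRe_real // realX // normr_real. Qed.

Lemma rdot_ge0 x : 0 <= rdot x x.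
Proof. by rewrite rdotxx sqr_ge0. Qed.

Lemma rdot_eq0 x : rdot x x = 0 -> x = 0.
Proof. by move/eqP; rewrite rdotxx sqrf_eq0 => /eqP/rnorm_eq0. Qed.

Lemma hdot_cauchy x y : rnorm (hdot x y) <= rnorm x * rnorm y.
Proof.
rewrite -ler_sqr ?nnegrE ?mulr_ge0 ?rnorm_ge0 // -lecR !rmorphXn rmorphM /=.
rewrite -!rnormE exprMn -!hdotxx; exact: dot_cauchy_schwarz.
Qed.

Lemma rdot_cauchy x y : rdot x y <= rnorm x * rnorm y.
Proof. exact: le_trans (Re_le_rnorm _) (hdot_cauchy _ _). Qed.

(** With [a] the conjugate of [hdot x y], the real part becomes [|hdot x y|^2]; so complex
    orthogonality follows from estimates of real parts. *)
Lemma hdot_eq0 x y : (forall a : Cplx R, rdot (a *: x) y = 0) -> hdot x y = 0.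
Proof.
move=> h; apply: rnorm_eq0; apply/eqP; rewrite -sqrf_eq0; apply/eqP.
rewrite -(h (hdot x y)^*) /rdot hdotZl mulrC -normCK rnormE -rmorphXn //=.
Qed.

Lemma hilbert_cauchy_filter (F : set_system X) : ProperFilter F ->
  (forall e : Cplx R, 0 < e -> exists x, F [set y | `|x - y| < e]) ->
  exists l, forall e : Cplx R, 0 < e -> F [set y | `|l - y| < e].
Proof.
move=> FF h.
have /cauchy_cvg/cvg_ex[l Fl] : cauchy F.
  apply: cauchy_exP => e e0; have [x Fx] := h _ e0; exists x.
  by rewrite -ball_normE.
by exists l => e e0; move/cvgrPdist_lt : Fl => /(_ _ e0).
Qed.

Lemma hilbert_cauchy_seq (u : nat -> X) :
  (forall e : R, 0 < e -> exists N, forall m n, (N <= m)%N -> (N <= n)%N ->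
    rnorm (u m - u n) < e) -> exists l, tends u l.
Proof.
move=> h; have [|l hl] := @hilbert_cauchy_filter (u @ \oo) _.
  move=> e /gt0_complex[r r0 ->]; have [N hN] := h _ r0; exists (u N).
  by exists N => // n nN; rewrite /= rnorm_lt; exact: hN.
exists l => e e0; have [|N _ hN] := hl e%:C%C; first by rewrite ltcR.
by exists N => n nN; rewrite rnormB -rnorm_lt; exact: hN.
Qed.

Lemma parallelogram x y :
  rdot (x + y) (x + y) + rdot (x - y) (x - y) = 2 * rdot x x + 2 * rdot y y.
Proof. by rewrite !(rdotDl, rdotDr, rdotNl, rdotNr) (rdotC y x); ring. Qed.

Record subspace_closed (V : set X) : Prop := SubspaceClosed {
  subspace0 : V 0;
  subspaceP : forall a u v, V u -> V v -> V (a *: u + v);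
  subspace_tends : forall u l, (forall n, V (u n)) -> tends u l -> V l
}.

Lemma subspaceZ V a u : subspace_closed V -> V u -> V (a *: u).
Proof. by move=> sV Vu; rewrite -[_ *: _]addr0; apply: subspaceP => //; apply: subspace0. Qed.

Lemma subspaceD V u v : subspace_closed V -> V u -> V v -> V (u + v).
Proof. by move=> sV Vu Vv; rewrite -[u]scale1r; apply: subspaceP. Qed.

(** A minimizing sequence for the squared distance [q] is Cauchy by the parallelogram law; its limit
    is [p], and varying it within [V] gives the orthogonality. *)
Lemma projection_theorem V x : subspace_closed V ->
  exists2 p, V p & forall v, V v -> hdot v (x - p) = 0.
Proof.
move=> sV; pose q v := rdot (x - v) (x - v).
pose D := [set q v | v in V].
have Dlb : has_lbound D by exists 0 => _ [v _ <-]; exact: rdot_ge0.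
have Dinf : has_inf D by split => //; exists (q 0), 0 => //; exact: subspace0.
pose d := inf D.
have dq v : V v -> d <= q v by move=> Vv; apply: ge_inf => //; exists v.
have /choice[u hu] (n : nat) : exists v, V v /\ q v < d + n.+1%:R^-1.
  have [|_ [v Vv <-] h] := @inf_adherent _ D n.+1%:R^-1 _ Dinf; first by rewrite invr_gt0.
  by exists v.
have small (e : R) : 0 < e -> exists N, forall n, (N <= n)%N -> q (u n) < d + e.
  move=> e0; have [N _ hN] := near_infty_natSinv_lt (PosNum e0).
  exists N => n nN; have [_ h] := hu n; apply: lt_trans h _.
  by rewrite ltrD2l; exact: (hN n).
have [p up] : exists p, tends u p.
  apply: hilbert_cauchy_seq => e e0.
  (* By the parallelogram law [|u m - u n|^2] is [2 q (u m) + 2 q (u n)] minus four times [q] of the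
     midpoint, hence below [4 (d + e^2/4) - 4 d = e^2]. *)
  have [|N hN] := small (e ^+ 2 / 4); first by rewrite divr_gt0 // exprn_gt0.
  exists N => m n /hN hm /hN hn.
  rewrite -ltr_sqr ?nnegrE ?rnorm_ge0 ?(ltW e0) // -rdotxx.
  have Vmid : V ((2^-1 : R)%:C%C *: (u m + u n)).
    by apply: subspaceZ => //; apply: subspaceD => //; [case: (hu m) | case: (hu n)].
  have := dq _ Vmid; move: hm hn; rewrite /q.
  have := parallelogram (x - u m) (x - u n).
  rewrite !(rdotDl, rdotDr, rdotNl, rdotNr, rdotZl, rdotZr).
  rewrite (rdotC (u m) x) (rdotC (u n) x) (rdotC (u n) (u m)); lra.
have Vp : V p by apply: subspace_tends up => // n; case: (hu n).
exists p => // v Vv; apply: hdot_eq0 => a.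
have Vw : V (a *: v) by exact: subspaceZ.
move: (a *: v) Vw => {Vv} {a} w Vw.
(* This is [|x - p|^2 <= |x - p - z|^2] expanded; it comes from [d <= q (u n + z)] in the limit. *)
have half z : V z -> rdot (x - p) z <= rdot z z / 2.
  move: z => {}v Vv; apply/ler_addgt0Pr => e e0.
  have v1 : 0 < rnorm v + 1 by rewrite ltr_wpDl // rnorm_ge0.
  have [N hN] := small _ e0; have [|M hM] := up (e / 2 / (rnorm v + 1)); first by rewrite !divr_gt0.
  pose n := maxn N M.
  have h1 := hN n (leq_maxl _ _); have := hM n (leq_maxr _ _).
  rewrite ltr_pdivlMr // => h2.
  have h3 : d <= q (u n + v) by apply: dq; apply: subspaceD => //; case: (hu n).
  have h4 := rdot_cauchy (u n - p) v.
  have h5 : 0 <= rnorm (u n - p) by exact: rnorm_ge0.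
  have -> : rdot (x - p) v = rdot (x - u n) v + rdot (u n - p) v.
    by rewrite -rdotDl addrA subrK.
  have h6 : q (u n + v) = q (u n) - 2 * rdot (x - u n) v + rdot v v.
    by rewrite /q !(rdotDl, rdotDr, rdotNl, rdotNr) (rdotC v x) (rdotC v (u n)); ring.
  have h7 : rdot (u n - p) v <= e / 2 by apply: le_trans h4 _; nra.
  move: h1 h3 h7; rewrite h6; lra.
set a := rdot (x - p) w; set b := rdot w w.
have b0 : 0 <= b by exact: rdot_ge0.
have b1 : 0 < b + 1 by rewrite ltr_wpDl.
(* At the multiple [t = a / (b + 1)] of [w], [half] reads [t a <= t^2 b / 2]; with [a = t (b + 1)]
   this forces [t = 0]. Adding 1 keeps the denominator positive when [w = 0]. *)
have := half ((a / (b + 1))%:C%C *: w) (subspaceZ _ sV Vw).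
rewrite !rdotZr rdotZl -/a -/b => h; rewrite rdotC -/a.
apply/eqP; rewrite -sqrf_eq0 eq_le sqr_ge0 andbT.
have hb : a / (b + 1) * (b + 1) = a by rewrite divfK // gt_eqF.
move: (a / (b + 1)) h hb => t h hb.
have h1 : t * (t * (b + 1)) <= t * (t * b) / 2 by rewrite hb.
have tb : 0 <= t ^+ 2 * b by rewrite mulr_ge0 ?sqr_ge0.
have : t ^+ 2 == 0 by rewrite eq_le sqr_ge0 andbT; lra.
by rewrite sqrf_eq0 -hb => /eqP ->; rewrite mul0r expr0n.
Qed.

End HilbertGeometry.

(** * Orthogonal projectors and their ranges *)

(** Closed subspaces are handled through their projectors; idempotence and self-adjointness already
    give [|P x| <= |x|] ([rnorm_proj]). *)
Record orthoproj (R : realType) (X : hilbertType R) := OrthoProj {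
  oproj :> {linear X -> X};
  oprojK : forall x, oproj (oproj x) = oproj x;
  oproj_adj : forall x y, hdot (oproj x) y = hdot x (oproj y)
}.

Section OrthoProj.
Variables (R : realType) (X : hilbertType R).
Implicit Types (P : orthoproj X) (x y : X).

(** The projection theorem chooses [p x]. Linearity holds because the point of [V] with residual
    orthogonal to [V] is unique: two such points differ by a vector orthogonal to itself. *)
Lemma orthoproj_onto (V : set X) : subspace_closed V ->
  exists P : orthoproj X, forall x, V x <-> P x = x.
Proof.
move=> sV.
have /choice[p hp] x : exists q, V q /\ forall v, V v -> hdot v (x - q) = 0.
  by have [q Vq h] := projection_theorem x sV; exists q.
have uniq x q : V q -> (forall v, V v -> hdot v (x - q) = 0) -> q = p x.
  move=> Vq h; have [Vp hpx] := hp x.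
  have Vd : V (q - p x).
    by rewrite addrC -scaleN1r; apply: subspaceP.
  apply/subr0_eq/rdot_eq0; rewrite /rdot.
  have e : q - p x = (x - p x) - (x - q) by rewrite opprB [RHS]addrC addrA subrK.
  by rewrite {2}e hdotBr /= hpx // h // subrr.
have linp a u v : p (a *: u + v) = a *: p u + p v.
  have [Vu hu] := hp u; have [Vv hv] := hp v.
  apply/esym/uniq; first exact: subspaceP.
  move=> w Vw; have -> : a *: u + v - (a *: p u + p v) = a *: (u - p u) + (v - p v).
    by rewrite scalerBr opprD addrACA.
  by rewrite hdotDr hdotZr /= hu // hv // mulr0 addr0.
have pK x : V x -> p x = x.
  by move=> Vx; apply/esym/uniq => // v Vv; rewrite subrr linear0r.
pose pL : {linear X -> X} := HB.pack p (GRing.isLinear.Build _ _ _ _ p linp).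
have half x y : hdot (p x) y = hdot (p x) (p y).
  have [Vx _] := hp x; have [_ hy] := hp y.
  by apply/subr0_eq; rewrite -hdotBr hy.
have Padj x y : hdot (pL x) y = hdot x (pL y).
  by rewrite /= half [RHS]hdotC [in RHS]half -hdotC.
have PK x : pL (pL x) = pL x by rewrite /= pK //; case: (hp x).
exists (OrthoProj PK Padj) => x; split => [/pK //| /= <-].
by case: (hp x).
Qed.

Lemma hdot_proj P x y : hdot (P x) y = hdot (P x) (P y).
Proof. by rewrite -oproj_adj oprojK. Qed.

Lemma rnorm_proj P x : rnorm (P x) <= rnorm x.
Proof.
have := rdot_cauchy (P x) x; rewrite /rdot hdot_proj -/(rdot _ _) rdotxx.
have [->|P0] := eqVneq (rnorm (P x)) 0; first by rewrite rnorm_ge0.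
by rewrite expr2 ler_pM2l // lt_def P0 rnorm_ge0.
Qed.

Lemma tends_proj P u l : tends u l -> tends (P \o u) (P l).
Proof.
apply: (@tends_lip _ _ _ P 1) => x y.
by rewrite mul1r -linearB rnorm_proj.
Qed.

Definition coproj P x := x - P x.

Fact coproj_linear P : linear (coproj P).
Proof. by move=> a u v; rewrite /coproj linearP scalerBr opprD addrACA. Qed.

HB.instance Definition _ P := GRing.isLinear.Build _ _ _ _ (coproj P) (coproj_linear P).

Fact coprojK P x : coproj P (coproj P x) = coproj P x.
Proof. by rewrite /coproj linearB /= oprojK subrr subr0. Qed.

Fact coproj_adj P x y : hdot (coproj P x) y = hdot x (coproj P y).
Proof. by rewrite /coproj hdotBl hdotBr oproj_adj. Qed.

Definition compl_proj P := @OrthoProj _ _ (coproj P) (coprojK P) (coproj_adj P).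

Lemma compl_projE P x : compl_proj P x = x - P x.
Proof. by []. Qed.

Lemma compl_proj_fix P x : compl_proj P x = x <-> P x = 0.
Proof.
split; rewrite compl_projE; last by move=> ->; rewrite subr0.
by move/eqP; rewrite -subr_eq0 addrC addKr oppr_eq0 => /eqP.
Qed.

End OrthoProj.

Section ProjRange.
Variables (R : realType) (X : hilbertType R) (P : orthoproj X).

(** The closed subspace as a type of its own, to carry the Hilbert structure inherited from [X];
    [prval] is the isometric inclusion. *)
Record prange := PRange { prval : X; prvalP : P prval == prval }.

HB.instance Definition _ := [isSub for prval].
HB.instance Definition _ := [Choice of prange by <:].

Fact prange_submod : GRing.subsemimod_closed [pred x | P x == x].
Proof.
split; first split.
- by rewrite !inE linear0.
- by move=> x y; rewrite !inE linearD => /eqP -> /eqP ->.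
- by move=> a x; rewrite !inE linearZ /= => /eqP ->.
Qed.

HB.instance Definition _ :=
  GRing.SubChoice_isSubLmodule.Build (Cplx R) X _ prange prange_submod.

Lemma prval_linear : linear prval.
Proof. by []. Qed.

HB.instance Definition _ := GRing.isLinear.Build _ _ _ _ prval prval_linear.

Definition prdot (x y : prange) : Cplx R := hdot (prval x) (prval y).

Fact prdot_bilinear : bilinear_for *%R (@Num.conj (Cplx R) \; *%R) prdot.
Proof.
by split=> z a x y; rewrite /prdot linearP /= ?hdotDl ?hdotZl // hdotDr hdotZr.
Qed.

HB.instance Definition _ := bilinear_isBilinear.Build _ _ _ _ _ _ prdot prdot_bilinear.

Fact prdot_herm x y : prdot x y = (-1) ^+ false * Num.conj (prdot y x).
Proof. by rewrite expr0 mul1r /prdot hdotC. Qed.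

HB.instance Definition _ := isHermitianSesquilinear.Build _ _ _ _ prdot prdot_herm.

Fact prdot_gt0 u : u != 0 -> 0 < prdot u u.
Proof.
by move=> u0; rewrite /prdot dnorm_gt0; apply: contraNneq u0 => h; apply/eqP/val_inj.
Qed.

HB.instance Definition _ := isDotProduct.Build _ _ prdot prdot_gt0.

Lemma prval_fix x : P (prval x) = prval x.
Proof. exact/eqP/prvalP. Qed.

Fact prange_complete (F : set_system prange) : ProperFilter F ->
  (forall e, 0 < e -> exists x, F [set y | prdot (x - y) (x - y) < e]) ->
  exists l, forall e, 0 < e -> F [set y | prdot (l - y) (l - y) < e].
Proof.
move=> FF h.
have nlt (x : X) (e : Cplx R) : 0 < e -> (`|x| < e) = (hdot x x < e ^+ 2).
  by move=> e0; rewrite hdotxx ltr_sqr ?nnegrE // ltW.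
have [e e0|l hl] := @hilbert_cauchy_filter _ _ (prval @ F) _.
  have [x Fx] := h _ (exprn_gt0 2 e0); exists (prval x).
  by apply: filterS Fx => y /= hy; rewrite nlt //; exact: hy.
(* The limit is first found in [X]; [P] fixes it because [P] does not increase distances and fixes
   every [prval y]. *)
have Pl : P l == l.
  apply/eqP/subr0_eq/rnorm_eq0/eqP; rewrite eq_le rnorm_ge0 andbT.
  apply/ler_addgt0Pr => e e0; rewrite add0r.
  have [|y /= hy] := @filter_ex _ F _ _ (hl (e / 2)%:C%C _); first by rewrite ltcR divr_gt0.
  move: hy; rewrite rnorm_lt => hy.
  have := rnorm_tri (prval y) (P l) l; rewrite -{1}prval_fix -linearB.
  have := rnorm_proj P (l - prval y); rewrite (rnormB (prval y)); lra.
exists (PRange Pl) => e e0.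
have e1 : 0 < sqrtC e by rewrite sqrtC_gt0.
by apply: (@filterS _ F _ _ _ _ (hl _ e1)) => y /=; rewrite nlt // sqrtCK => hy; exact: hy.
Qed.

HB.instance Definition _ := Lmodule_isHilbert.Build R prange prange_complete.

Lemma hdot_prange (x y : prange) : hdot x y = hdot (prval x) (prval y).
Proof. by []. Qed.

Lemma rnorm_prange (x : prange) : rnorm x = rnorm (prval x).
Proof.
by apply/eqP; rewrite -(@eqrXn2 _ 2) ?rnorm_ge0 // -!rdotxx.
Qed.

Definition prproj (x : X) : prange := PRange (introT eqP (oprojK P x)).

Lemma prprojK (x : prange) : prproj (prval x) = x.
Proof. by apply: val_inj; rewrite /= prval_fix. Qed.

End ProjRange.

(** * The orthogonal sum of two Hilbert spaces, in which graphs live *)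

Section HilbertProduct.
Variables (R : realType) (X Y : hilbertType R).

(** A separate name for the product, because [X * Y] itself already carries the maximum norm instead
    of the Euclidean one. *)
Definition hprod : Type := (X * Y)%type.

HB.instance Definition _ := GRing.Lmodule.copy hprod (X * Y)%type.

Definition hpdot (p q : hprod) : Cplx R := hdot p.1 q.1 + hdot p.2 q.2.

Fact hpdot_bilinear : bilinear_for *%R (@Num.conj (Cplx R) \; *%R) hpdot.
Proof.
split=> [[z1 z2] a [x1 x2] [y1 y2]|[z1 z2] a [x1 x2] [y1 y2]]; rewrite /hpdot /=.
  by rewrite !hdotDl !hdotZl mulrDr addrACA.
by rewrite !hdotDr !hdotZr mulrDr addrACA.
Qed.

HB.instance Definition _ := bilinear_isBilinear.Build _ _ _ _ _ _ hpdot hpdot_bilinear.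

Fact hpdot_herm x y : hpdot x y = (-1) ^+ false * Num.conj (hpdot y x).
Proof. by rewrite expr0 mul1r /hpdot rmorphD /= -!hdotC. Qed.

HB.instance Definition _ := isHermitianSesquilinear.Build _ _ _ _ hpdot hpdot_herm.

Fact hpdot_gt0 u : u != 0 -> 0 < hpdot u u.
Proof.
case: u => x y u0; rewrite /hpdot /= lt_def addr_ge0 ?dnorm_ge0 // andbT.
apply: contraNneq u0 => /eqP; rewrite paddr_eq0 ?dnorm_ge0 // !dnorm_eq0.
by case/andP => /eqP -> /eqP ->.
Qed.

HB.instance Definition _ := isDotProduct.Build _ _ hpdot hpdot_gt0.

Fact hprod_complete (F : set_system hprod) : ProperFilter F ->
  (forall e, 0 < e -> exists x, F [set y | hpdot (x - y) (x - y) < e]) ->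
  exists l, forall e, 0 < e -> F [set y | hpdot (l - y) (l - y) < e].
Proof.
move=> FF h.
have nlt (Z : hilbertType R) (x : Z) (e : Cplx R) :
    0 < e -> (`|x| < e) = (hdot x x < e ^+ 2).
  by move=> e0; rewrite hdotxx ltr_sqr ?nnegrE // ltW.
have [e e0|l1 hl1] := @hilbert_cauchy_filter _ _ (fst @ F) _.
  have [x Fx] := h _ (exprn_gt0 2 e0); exists x.1.
  apply: (@filterS _ F _ _ _ _ Fx) => y /= hy; rewrite nlt //.
  by apply: le_lt_trans hy; rewrite /hpdot lerDl dnorm_ge0.
have [e e0|l2 hl2] := @hilbert_cauchy_filter _ _ (snd @ F) _.
  have [x Fx] := h _ (exprn_gt0 2 e0); exists x.2.
  apply: (@filterS _ F _ _ _ _ Fx) => y /= hy; rewrite nlt //.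
  by apply: le_lt_trans hy; rewrite /hpdot lerDr dnorm_ge0.
exists (l1, l2) => e e0.
have e2 : 0 < sqrtC (e / 2) by rewrite sqrtC_gt0 divr_gt0.
apply: (@filterS2 _ F _ _ _ _ _ (hl1 _ e2) (hl2 _ e2)) => y /=.
by rewrite !nlt // sqrtCK => h1 h2; rewrite [e]splitr; exact: ltrD.
Qed.

HB.instance Definition _ := Lmodule_isHilbert.Build R hprod hprod_complete.

Lemma hdot_hprod (p q : hprod) : hdot p q = hdot p.1 q.1 + hdot p.2 q.2.
Proof. by []. Qed.

Lemma rdot_hprod (p q : hprod) : rdot p q = rdot p.1 q.1 + rdot p.2 q.2.
Proof. by rewrite /rdot hdot_hprod raddfD. Qed.

Lemma rnorm_fst (p : hprod) : rnorm p.1 <= rnorm p.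
Proof. by rewrite -ler_sqr ?nnegrE ?rnorm_ge0 // -!rdotxx rdot_hprod lerDl rdot_ge0. Qed.

Lemma rnorm_snd (p : hprod) : rnorm p.2 <= rnorm p.
Proof. by rewrite -ler_sqr ?nnegrE ?rnorm_ge0 // -!rdotxx rdot_hprod lerDr rdot_ge0. Qed.

End HilbertProduct.

(** * Square roots of positive operators *)

Section Limits.
Variable R : realType.

Lemma tends_ext (V : normedZmodType (Cplx R)) (u v : nat -> V) l :
  (forall n, u n = v n) -> tends u l -> tends v l.
Proof. by move=> /funext ->. Qed.

Lemma tendsD (V : normedZmodType (Cplx R)) (u v : nat -> V) l m :
  tends u l -> tends v m -> tends (fun n => u n + v n) (l + m).
Proof.
move=> ul vm e e0; have e2 : 0 < e / 2 by rewrite divr_gt0.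
have [N hN] := ul _ e2; have [M hM] := vm _ e2.
exists (maxn N M) => n; rewrite geq_max => /andP[/hN h1 /hM h2].
rewrite opprD addrACA [e]splitr; apply: le_lt_trans (rnormD _ _) _; exact: ltrD.
Qed.

Lemma tendsZ (V : normedModType (Cplx R)) (a : Cplx R) (u : nat -> V) l :
  tends u l -> tends (fun n => a *: u n) (a *: l).
Proof.
apply: (@tends_lip _ _ _ (fun z => a *: z) (rnorm a)) => x y.
by rewrite -scalerBr rnormZ.
Qed.

Lemma tends_rnorm_le (V : normedZmodType (Cplx R)) (u : nat -> V) l (c : R) :
  tends u l -> (forall n, rnorm (u n) <= c) -> rnorm l <= c.
Proof.
move=> ul uc; apply/ler_addgt0Pr => e e0.
have [N /(_ N (leqnn _)) h] := ul _ e0.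
have := uc N; have := rnorm_tri (u N) l 0; rewrite !subr0 (rnormB l); lra.
Qed.

Lemma tends_hdotl (X : hilbertType R) (u : nat -> X) l y :
  tends u l -> tends (fun n => hdot (u n) y) (hdot l y).
Proof.
apply: (@tends_lip _ _ _ (fun z => hdot z y) (rnorm y)) => a b.
by rewrite -hdotBl mulrC; exact: hdot_cauchy.
Qed.

Lemma tends_hdotr (X : hilbertType R) (u : nat -> X) l y :
  tends u l -> tends (fun n => hdot y (u n)) (hdot y l).
Proof.
apply: (@tends_lip _ _ _ (fun z => hdot y z) (rnorm y)) => a b.
by rewrite -hdotBr; exact: hdot_cauchy.
Qed.

End Limits.

Section SquareRoot.
Variables (R : realType) (X : hilbertType R) (B : {linear X -> X}).
Hypothesis Bcontr : forall x, rnorm (B x) <= rnorm x.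
Hypothesis Badj : forall x y, hdot (B x) y = hdot x (B y).

(* The limit [Y] of this iteration satisfies [2 Y = B + Y^2], that is
   [(1 - Y)^2 = 1 - B].  As [root_iter n] is a polynomial in [B] with nonnegative
   coefficients, its increments are dominated by those of the same iteration at
   [B = 1], which is [root_bound]. *)
Fixpoint root_iter (n : nat) (x : X) : X :=
  if n is n'.+1 then (2^-1 : R)%:C%C *: (B x + root_iter n' (root_iter n' x)) else 0.

Fixpoint root_bound (n : nat) : R :=
  if n is n'.+1 then (1 + root_bound n' ^+ 2) / 2 else 0.

Lemma root_iter_linear n : linear (root_iter n).
Proof.
elim: n => [|n IH] a u v /=; first by rewrite scaler0 addr0.
rewrite linearP !IH scalerA mulrC -scalerA -scalerDr; congr (_ *: _).
by rewrite scalerDr addrACA.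
Qed.

HB.instance Definition _ n := GRing.isLinear.Build _ _ _ _ (root_iter n) (@root_iter_linear n).

Lemma root_iterD n x y : root_iter n (x + y) = root_iter n x + root_iter n y.
Proof. exact: linearD. Qed.

(** [root_iter n] is a polynomial in [B], so it commutes with whatever commutes with [B]. *)
Lemma root_iter_comm (A : {linear X -> X}) : (forall x, A (B x) = B (A x)) ->
  forall n x, A (root_iter n x) = root_iter n (A x).
Proof.
move=> AB; elim=> [|n IH] x /=; first by rewrite linear0.
by rewrite linearZ linearD /= AB !IH.
Qed.

Lemma root_iter_commute m n x :
  root_iter m (root_iter n x) = root_iter n (root_iter m x).
Proof.
apply: root_iter_comm => {}x; apply/esym.
exact: root_iter_comm.
Qed.

Lemma root_iter_adj n x y : hdot (root_iter n x) y = hdot x (root_iter n y).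
Proof.
elim: n x y => [|n IH] x y /=; first by rewrite linear0l linear0r.
rewrite hdotZl hdotZr hdotDl hdotDr Badj !IH; congr (_ * _).
by rewrite conj_Creal //; apply/complex_realP; exists 2^-1.
Qed.

Lemma root_bound_ge0 n : 0 <= root_bound n.
Proof. by case: n => //= n; rewrite divr_ge0 // addr_ge0 // sqr_ge0. Qed.

Lemma root_bound_le1 n : root_bound n <= 1.
Proof. by elim: n => //= n IH; have := root_bound_ge0 n; nra. Qed.

Lemma rnorm_half (z : X) : rnorm ((2^-1 : R)%:C%C *: z) = rnorm z / 2.
Proof. by rewrite rnormZ rnorm_real ger0_norm ?invr_ge0 // mulrC. Qed.

Lemma root_iter_le n x : rnorm (root_iter n x) <= root_bound n * rnorm x.
Proof.
elim: n x => [|n IH] x /=; first by rewrite rnorm0 mul0r.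
rewrite rnorm_half.
have h1 := rnormD (B x) (root_iter n (root_iter n x)).
have h2 := Bcontr x; have h3 := IH (root_iter n x).
have h4 := ler_wpM2l (root_bound_ge0 n) (IH x); lra.
Qed.

Lemma root_iter_contr n x : rnorm (root_iter n x) <= rnorm x.
Proof.
apply: le_trans (root_iter_le _ _) _.
by rewrite ler_piMl ?rnorm_ge0 ?root_bound_le1.
Qed.

(** As the iterates commute, the increment [(Y_{n+1}^2 - Y_n^2) / 2] factors as
    [(Y_{n+1} - Y_n)(Y_{n+1} + Y_n) / 2]; induction bounds the first factor and [root_iter_le] the
    second, as for the scalars. *)
Lemma root_iter_diff n x : rnorm (root_iter n.+1 x - root_iter n x)
  <= (root_bound n.+1 - root_bound n) * rnorm x.
Proof.
elim: n x => [|n IH] x.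
  rewrite /= subr0 addr0 rnorm_half expr0n addr0 subr0 mul1r mulrC.
  by apply: ler_wpM2l; rewrite ?invr_ge0.
have -> : root_iter n.+2 x - root_iter n.+1 x = (2^-1 : R)%:C%C *:
    (root_iter n.+1 (root_iter n.+1 x + root_iter n x) -
     root_iter n (root_iter n.+1 x + root_iter n x)).
  transitivity ((2^-1 : R)%:C%C *: (B x + root_iter n.+1 (root_iter n.+1 x)) -
    (2^-1 : R)%:C%C *: (B x + root_iter n (root_iter n x))); first by [].
  rewrite -scalerBr !root_iterD (root_iter_commute n n.+1).
  by congr (_ *: _); rewrite (addrC (B x)) !addrKA.
rewrite rnorm_half.
set y := root_iter n.+1 x + root_iter n x.
have h1 := IH y.
have h2 : rnorm y <= (root_bound n.+1 + root_bound n) * rnorm x.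
  by rewrite mulrDl; apply: le_trans (rnormD _ _) _; apply: lerD; exact: root_iter_le.
have h0 : 0 <= root_bound n.+1 - root_bound n.
  by rewrite /=; have := sqr_ge0 (root_bound n - 1); lra.
have h3 := ler_wpM2l h0 h2.
have -> : root_bound n.+2 - root_bound n.+1 =
  (root_bound n.+1 ^+ 2 - root_bound n ^+ 2) / 2 by rewrite /=; ring.
lra.
Qed.

Lemma root_iter_diff2 m n x : (m <= n)%N ->
  rnorm (root_iter n x - root_iter m x) <= (root_bound n - root_bound m) * rnorm x.
Proof.
elim: n => [|n IH]; first by rewrite leqn0 => /eqP ->; rewrite !subrr rnorm0 mul0r.
rewrite leq_eqVlt ltnS => /orP[/eqP ->|/IH h]; first by rewrite !subrr rnorm0 mul0r.
have := rnorm_tri (root_iter n x) (root_iter n.+1 x) (root_iter m x).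
have := root_iter_diff n x; lra.
Qed.

(** The scalars [root_bound n] increase and stay at most 1, so their differences become small and
    dominate those of [root_iter n x]. *)
Lemma root_iter_cvg x : exists l, tends (root_iter ^~ x) l.
Proof.
apply: hilbert_cauchy_seq => e e0.
pose D := range root_bound.
have Dsup : has_sup D.
  by split; [exists 0, 0%N|exists 1 => _ [n _ <-]; exact: root_bound_le1].
have x1 : 0 < rnorm x + 1 by rewrite ltr_wpDl // rnorm_ge0.
have [|_ [N _ <-] hN] := @sup_adherent _ D (e / 2 / (rnorm x + 1)) _ Dsup.
  by rewrite !divr_gt0.
exists N => m n Nm Nn.
have h k : (N <= k)%N -> rnorm (root_iter k x - root_iter N x) < e / 2.
  move=> Nk; apply: le_lt_trans (root_iter_diff2 _ Nk) _.
  have kD : root_bound k <= sup D by apply: sup_upper_bound => //; exists k.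
  have : root_bound k - root_bound N <= e / 2 / (rnorm x + 1) by lra.
  move/(ler_wpM2r (rnorm_ge0 x))/le_lt_trans; apply.
  rewrite mulrAC ltr_pdivrMr // ltr_pM2l ?divr_gt0 //; lra.
have := rnorm_tri (root_iter N x) (root_iter m x) (root_iter n x).
rewrite (rnormB (root_iter N x)); have := h _ Nm; have := h _ Nn; lra.
Qed.

(** [Y] is the pointwise limit of the iterates and inherits their properties. The last clause
    replaces functional calculus: [Y] commutes with every bounded operator that commutes with
    [B]. *)
Lemma square_root : exists Y : {linear X -> X},
  [/\ forall x, rnorm (Y x) <= rnorm x,
      forall x y, hdot (Y x) y = hdot x (Y y),
      forall x, Y x + Y x = B x + Y (Y x) &
      forall (A : {linear X -> X}) (c : R), (forall x, rnorm (A x) <= c * rnorm x) ->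
        (forall x, A (B x) = B (A x)) -> forall x, A (Y x) = Y (A x)].
Proof.
have /choice[Y hY] := root_iter_cvg.
have linY : linear Y.
  move=> a u v; apply: (tends_unique (hY _)).
  have := tendsD (tendsZ a (hY u)) (hY v).
  by apply: tends_ext => n; rewrite /= linearP.
pose YL : {linear X -> X} := HB.pack Y (GRing.isLinear.Build _ _ _ _ Y linY).
have contr x : rnorm (Y x) <= rnorm x.
  by apply: (tends_rnorm_le (hY x)) => n; exact: root_iter_contr.
exists YL; split => //=.
- move=> x y; apply: (tends_unique (tends_hdotl y (hY x))).
  have := tends_hdotr x (hY y).
  by apply: tends_ext => n; rewrite /= root_iter_adj.
- move=> x.
  have YY : tends (fun n => root_iter n (root_iter n x)) (Y (Y x)).
    (* [root_iter n (root_iter n x)] differs from [root_iter n (Y x)] by [root_iter n] of a null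
       sequence, and these maps are contractions. *)
    have h1 : tends (fun n => root_iter n (root_iter n x - Y x)) 0.
      move=> e e0; have [N hN] := hY x _ e0; exists N => n /hN h.
      by rewrite subr0; apply: le_lt_trans (root_iter_contr _ _) h.
    have := tendsD h1 (hY (Y x)); rewrite add0r.
    by apply: tends_ext => n; rewrite /= -linearD subrK.
  have h2 : tends (fun n => root_iter n.+1 x) (Y x).
    by move=> e e0; have [N hN] := hY x _ e0; exists N => n Nn; apply: hN; exact: leqW.
  have h3 := tendsZ (2^-1 : R)%:C%C (tendsD (tends_const (B x)) YY).
  rewrite {1 2}(tends_unique h2 h3) -scalerDl -rmorphD /=.
  by rewrite [X in X%:C%C](_ : _ = 1) ?scale1r //; lra.
- move=> A c Ac AB x; apply: (@tends_unique _ _ (fun n => A (root_iter n x))).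
    by apply: (@tends_lip _ _ _ A c) => // a b; rewrite -linearB.
  by have := hY (A x); apply: tends_ext => n; rewrite /= root_iter_comm.
Qed.

End SquareRoot.

(** * Splitting along the sign of a self-adjoint contraction *)

Lemma bundle_linear (R : nzRingType) (U V : lmodType R) (f : U -> V) :
  linear f -> exists L : {linear U -> V}, forall x, L x = f x.
Proof.
move=> lf; pose L : {linear U -> V} := HB.pack f (GRing.isLinear.Build _ _ _ _ f lf).
by exists L.
Qed.

Section SignSplitting.
Variables (R : realType) (X : hilbertType R).

Lemma hdot_ext (x y : X) : (forall z, hdot x z = hdot y z) -> x = y.
Proof. by move=> h; apply/subr0_eq/rdot_eq0; rewrite /rdot hdotBl h subrr. Qed.

(** Invariance of the range reads [K A K = A K]; taking adjoints gives [K A K = K A]. *)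
Lemma orthoproj_commute (K : orthoproj X) (A : {linear X -> X}) :
  (forall x y, hdot (A x) y = hdot x (A y)) ->
  (forall x, K x = x -> K (A x) = A x) -> forall x, K (A x) = A (K x).
Proof.
move=> Aadj KA x; have KAK y : K (A (K y)) = A (K y) by rewrite KA // oprojK.
apply: hdot_ext => y.
by rewrite oproj_adj Aadj -(KAK y) -oproj_adj -Aadj -oproj_adj KAK.
Qed.

(** [M = 1 - Y] is [|J|], as [M^2 = 1 - B = J^2], and [K] projects onto the kernel of [M + J]. There
    [J = -M], while [(M + J)(M - J) = 0] makes [J = M] on the orthogonal complement. The clause on
    [P] later shows that [K] preserves the graph. *)
Lemma sign_splitting (J : {linear X -> X}) :
  (forall x, rnorm (J x) <= rnorm x) ->
  (forall x y, hdot (J x) y = hdot x (J y)) ->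
  exists K : orthoproj X,
    [/\ forall x, K (J x) = J (K x),
        forall P : orthoproj X, (forall x, P (J x) = J (P x)) ->
          forall x, P (K x) = K (P x),
        forall x, K x = x -> rdot (J x) x <= 0 &
        forall x, K x = 0 -> 0 <= rdot (J x) x].
Proof.
move=> Jcontr Jadj.
have [B Bdef] : exists B : {linear X -> X}, forall x, B x = x - J (J x).
  by apply: bundle_linear => a u v /=; rewrite !(linearP J) scalerBr opprD addrACA.
have Badj x y : hdot (B x) y = hdot x (B y).
  by rewrite !Bdef hdotBl hdotBr !Jadj.
(* [|B x|^2 = |x|^2 - 2 |J x|^2 + |J (J x)|^2], and the last term is at most [|J x|^2]. *)
have Bcontr x : rnorm (B x) <= rnorm x.
  rewrite -ler_sqr ?nnegrE ?rnorm_ge0 // -!rdotxx Bdef.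
  have : rdot (J (J x)) x = rdot (J x) (J x) by rewrite /rdot Jadj.
  have : rdot (J (J x)) (J (J x)) <= rdot (J x) (J x).
    by rewrite !rdotxx ler_sqr ?nnegrE ?rnorm_ge0.
  have := rdot_ge0 (J x).
  rewrite rdotBl !rdotBr (rdotC x (J (J x))); lra.
have [Y [Ycontr Yadj Yeq Ycomm]] := square_root Bcontr Badj.
have [M Mdef] : exists M : {linear X -> X}, forall x, M x = x - Y x.
  by apply: bundle_linear => a u v /=; rewrite (linearP Y) scalerBr; rewrite opprD addrACA.
have MM x : M (M x) = J (J x).
  have -> : J (J x) = x - B x by rewrite Bdef opprB addrC subrK.
  have -> : B x = Y x + Y x - Y (Y x) by rewrite Yeq addrK.
  by rewrite !Mdef linearB /= -addrA -opprD addrA.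
have Madj x y : hdot (M x) y = hdot x (M y).
  by rewrite !Mdef hdotBl hdotBr Yadj.
have commM (A : {linear X -> X}) (c : R) : (forall x, rnorm (A x) <= c * rnorm x) ->
    (forall x, A (J x) = J (A x)) -> forall x, A (M x) = M (A x).
  move=> Ac AJ x; rewrite !Mdef linearB /= (Ycomm A c) // => {}x.
  by rewrite !Bdef linearB /= !AJ.
have JM x : J (M x) = M (J x) by apply: (commM J 1) => // {}x; rewrite mul1r.
pose V := [set x | M x + J x = 0].
have sV : subspace_closed V.
  split.
  - by rewrite /V /= !linear0 addr0.
  - move=> a u v; rewrite /V /= => hu hv.
    by rewrite (linearP M) (linearP J) addrACA -scalerDr hu hv scaler0 addr0.
  - move=> u l Vu ul; apply: (@tends_unique _ _ (fun n => M (u n) + J (u n))).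
      apply: tendsD.
        apply: (@tends_lip _ _ _ M 2) ul => x y; rewrite -linearB Mdef.
        have := rnormD (x - y) (- Y (x - y)); rewrite rnormN.
        have := Ycontr (x - y); lra.
      by apply: (@tends_lip _ _ _ J 1) ul => x y; rewrite -linearB mul1r.
    by under eq_fun do rewrite Vu; exact: tends_const.
have [K KV] := orthoproj_onto sV.
have commK (A : {linear X -> X}) : (forall x y, hdot (A x) y = hdot x (A y)) ->
    (forall x, A (J x) = J (A x)) -> (forall x, A (M x) = M (A x)) ->
    forall x, K (A x) = A (K x).
  move=> Aadj AJ AM; apply: orthoproj_commute => // x /KV Vx.
  by apply/KV; rewrite /V /= -AJ -AM -linearD [_ + _]Vx linear0.
have KJ := commK J Jadj (fun=> erefl) JM.
have KM := commK M Madj (fun x => esym (JM x)) (fun=> erefl).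
have Mge0 x : 0 <= rdot (M x) x.
  rewrite Mdef rdotBl rdotxx.
  have := rdot_cauchy (Y x) x; have := Ycontr x; have := rnorm_ge0 x; nra.
exists K; split => //.
- move=> P PJ x; apply/esym/commK => //; first exact: oproj_adj.
  by apply: (commM P 1) => // {}x; rewrite mul1r rnorm_proj.
- move=> x /KV; rewrite /V /= addrC => /eqP; rewrite addr_eq0 => /eqP ->.
  by rewrite rdotNl oppr_le0; exact: Mge0.
- move=> x Kx; suff -> : J x = M x by exact: Mge0.
  apply/esym/subr0_eq.
  (* [M x - J x] lies in [V], so [K] fixes it; moving [K] past [M] and [J] then leaves
     [(M - J) (K x) = 0]. *)
  have -> : M x - J x = K (M x - J x).
    apply/esym/KV; rewrite /V /= (linearB M) (linearB J) MM.
    by rewrite -JM addrC addrA subrK subrr.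
  by rewrite (linearB K) KM KJ Kx (linear0 M) (linear0 J) subrr.
Qed.

End SignSplitting.

(** * Splitting a closed operator into a contractive and an expansive part *)

Section ContractionSplitting.
Variables (R : realType) (X X0 : hilbertType R) (T : linear_operator X X0).
Hypothesis Tclosed : closed_operator T.

Lemma lopD x y : lop_dom T x -> lop_dom T y ->
  lop_dom T (x + y) /\ T (x + y) = T x + T y.
Proof.
move=> dx dy; have := lop_linear 1 dx dy; have := lop_domP 1 dx dy.
by rewrite !scale1r.
Qed.

Lemma lopB x y : lop_dom T x -> lop_dom T y ->
  lop_dom T (x - y) /\ T (x - y) = T x - T y.
Proof.
move=> dx dy; have := lop_linear (-1) dy dx; have := lop_domP (-1) dy dx.
by rewrite !scaleN1r ![- _ + _]addrC.
Qed.

(** [P] projects onto [A], where [|T f| <= |f|], and [P0] onto the complement of [D], the image of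
    the part where [|f| <= |T f|]. Each inequality passes the Cauchy property between [f] and [T f],
    so closedness of the graph makes [A] and [D] closed. *)
Lemma contraction_splitting : exists (P : orthoproj X) (P0 : orthoproj X0),
  [/\ forall f, lop_dom T f -> lop_dom T (P f) /\ T (P f) = P0 (T f),
      forall f, P f = f -> lop_dom T f /\ rnorm (T f) <= rnorm f,
      forall f, lop_dom T f -> P f = 0 -> rnorm f <= rnorm (T f) &
      forall h, P0 h = 0 -> exists f, [/\ lop_dom T f, P f = 0 & T f = h]].
Proof.
pose H := hprod X X0.
pose G : set H := [set p | lop_dom T p.1 /\ p.2 = T p.1].
have tends1 (u : nat -> H) l : tends u l -> tends (fun n => (u n).1) l.1.
  by apply: (@tends_lip _ _ _ (fun p : H => p.1) 1) => x y; rewrite mul1r (rnorm_fst (x - y)).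
have tends2 (u : nat -> H) l : tends u l -> tends (fun n => (u n).2) l.2.
  by apply: (@tends_lip _ _ _ (fun p : H => p.2) 1) => x y; rewrite mul1r (rnorm_snd (x - y)).
have sG : subspace_closed G.
  split.
  - split; first exact: lop_dom0.
    by have [_ /=] := lopB (lop_dom0 T) (lop_dom0 T); rewrite !subrr.
  - move=> a [u1 u2] [v1 v2] [/= du ->] [/= dv ->].
    by split; rewrite /= ?lop_linear //; exact: lop_domP.
  - move=> u [l1 l2] Gu ul.
    apply: (closed_tends2 Tclosed _ (tends1 _ _ ul) (tends2 _ _ ul)) => n.
    exact: Gu.
have [E EG] := orthoproj_onto sG.
pose g f : H := (f, T f).
have gG f : lop_dom T f -> E (g f) = g f by move=> df; apply/EG.
(* On the graph the form of [S] is [|f|^2 - |T f|^2]; [J] is its compression to the graph. *)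
have [S Sdef] : exists S : {linear H -> H}, forall p, S p = (p.1, - p.2).
  apply: bundle_linear => a u v /=; congr (_, _).
  by rewrite /= opprD -scalerN.
have Sadj x y : hdot (S x) y = hdot x (S y).
  by rewrite !Sdef !hdot_hprod /= linearNl linearNr.
have Scontr x : rnorm (S x) <= rnorm x.
  rewrite -ler_sqr ?nnegrE ?rnorm_ge0 // -!rdotxx Sdef !rdot_hprod /=.
  by rewrite rdotNl rdotNr opprK.
have [J Jdef] : exists J : {linear H -> H}, forall p, J p = E (S (E p)).
  by apply: bundle_linear => a u v; rewrite (linearP E) (linearP S) (linearP E).
have Jadj x y : hdot (J x) y = hdot x (J y).
  by rewrite !Jdef oproj_adj Sadj oproj_adj.
have Jcontr x : rnorm (J x) <= rnorm x.
  by rewrite Jdef; apply: le_trans (rnorm_proj _ _) (le_trans (Scontr _) (rnorm_proj _ _)).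
have [K [KJ KE Kneg Kpos]] := sign_splitting Jcontr Jadj.
(* [J = E S E] commutes with [E], hence so does [K]: it maps the graph into itself. *)
have {}KE x : E (K x) = K (E x) by apply: KE => {}x; rewrite !Jdef !oprojK.
have hJ f f' : lop_dom T f -> lop_dom T f' ->
    hdot (J (g f)) (g f') = hdot f f' - hdot (T f) (T f').
  move=> df df'; rewrite Jdef oproj_adj !gG // Sdef hdot_hprod /= linearNl.
  by [].
have rJ f : lop_dom T f -> rdot (J (g f)) (g f) = rnorm f ^+ 2 - rnorm (T f) ^+ 2.
  by move=> df; rewrite /rdot hJ // raddfB /= -!/(rdot _ _) !rdotxx.
have posT f : lop_dom T f -> K (g f) = 0 -> rnorm (T f) <= rnorm f.
  move=> df /Kpos; rewrite rJ // subr_ge0.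
  by rewrite ler_sqr ?nnegrE ?rnorm_ge0.
have negT f : lop_dom T f -> K (g f) = g f -> rnorm f <= rnorm (T f).
  move=> df /Kneg; rewrite rJ // subr_le0.
  by rewrite ler_sqr ?nnegrE ?rnorm_ge0.
have tends_g u l : tends u l.1 -> tends (T \o u) l.2 -> tends (g \o u) l.
  case: l => l1 l2 u1 u2; rewrite /g.
  move=> e e0; have e2 : 0 < e / 2 by rewrite divr_gt0.
  have [N hN] := u1 _ e2; have [M hM] := u2 _ e2.
  exists (maxn N M) => n; rewrite geq_max => /andP[/hN h1 /hM h2].
  rewrite -ltr_sqr ?nnegrE ?rnorm_ge0 ?(ltW e0) // -rdotxx rdot_hprod /=.
  move: h1 h2; rewrite !rdotxx /=.
  have := rnorm_ge0 (u n - l1); have := rnorm_ge0 (T (u n) - l2); nra.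
have closedK (u : nat -> X) l : (forall n, lop_dom T (u n)) -> tends u l.1 ->
    tends (T \o u) l.2 -> [/\ lop_dom T l.1, l = g l.1 & tends (K \o (g \o u)) (K l)].
  move=> du u1 u2; have ul := tends_g _ _ u1 u2.
  have [dl hl] : G l by apply: (subspace_tends sG _ ul) => n; split => //; exact: du.
  split => //; first by case: l hl {u1 u2 ul dl} => a b /= ->.
  exact: tends_proj.
pose A := [set f | lop_dom T f /\ K (g f) = 0].
pose D := [set h | exists f, [/\ lop_dom T f, T f = h & K (g f) = g f]].
have gP a u v : lop_dom T u -> lop_dom T v -> g (a *: u + v) = a *: g u + g v.
  by move=> du dv; rewrite /g lop_linear.
have g0 : g 0 = 0.
  by have := gP (-1) _ _ (lop_dom0 T) (lop_dom0 T); rewrite !scaleN1r !addNr.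
have gB u v : lop_dom T u -> lop_dom T v -> g (u - v) = g u - g v.
  by move=> du dv; rewrite /g (lopB du dv).2.
have sA : subspace_closed A.
  split.
  - by split; [exact: lop_dom0|rewrite g0 linear0].
  - move=> a u v [du Ku] [dv Kv]; split; first exact: lop_domP.
    by rewrite gP // linearP /= Ku Kv scaler0 addr0.
  - move=> u l Au ul.
    have du n : lop_dom T (u n) by case: (Au n).
    have [h uh] : exists h, tends (T \o u) h.
      apply: hilbert_cauchy_seq => e e0; have [|N hN] := ul (e / 2); first by rewrite divr_gt0.
      exists N => m n /hN hm /hN hn /=; rewrite -(lopB (du m) (du n)).2.
      apply: le_lt_trans (posT _ (lopB (du m) (du n)).1 _) _.
        by rewrite gB // linearB /= (Au m).2 (Au n).2 subrr.
      have := rnorm_tri l (u m) (u n); rewrite (rnormB l); lra.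
    have [dl el Kl] := closedK u (l, h) du ul uh.
    split=> //; rewrite -[g l]el; apply: (tends_unique Kl).
    by apply: tends_ext (tends_const 0) => n /=; rewrite (Au n).2.
have sD : subspace_closed D.
  split.
  - by exists 0; rewrite g0 linear0; split => //; [exact: lop_dom0|case: g0].
  - move=> a _ _ [u [du <- Ku]] [v [dv <- Kv]]; exists (a *: u + v).
    by split; rewrite ?lop_linear // ?gP ?linearP /= ?Ku ?Kv //; exact: lop_domP.
  - move=> w h Dw wh; have [u hu] := choice Dw.
    have du n : lop_dom T (u n) by case: (hu n).
    have Tu n : T (u n) = w n by case: (hu n).
    have Ku n : K (g (u n)) = g (u n) by case: (hu n).
    have uh : tends (T \o u) h by apply: tends_ext wh => n /=; rewrite Tu.
    have [l ul] : exists l, tends u l.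
      apply: hilbert_cauchy_seq => e e0; have [|N hN] := uh (e / 2); first by rewrite divr_gt0.
      exists N => m n /hN /= hm /hN /= hn.
      apply: le_lt_trans (negT _ (lopB (du m) (du n)).1 _) _.
        by rewrite gB // linearB /= !Ku.
      rewrite (lopB (du m) (du n)).2.
      have := rnorm_tri h (T (u m)) (T (u n)); rewrite (rnormB h); lra.
    have [dl el Kl] := closedK u (l, h) du ul uh.
    exists l; split => //; first by case: el.
    rewrite -[g l]el; apply: (tends_unique Kl).
    by apply: tends_ext (tends_g _ (l, h) ul uh) => n /=; rewrite Ku.
have [P PA] := orthoproj_onto sA.
have [Q QD] := orthoproj_onto sD.
(* Orthogonality of the graph vectors makes the sum of the two inner products vanish, orthogonality
   for the form of [J] their difference; so both vanish. *)
have orth a f : lop_dom T a -> lop_dom T f -> K (g a) = 0 -> K (g f) = g f ->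
    hdot a f = 0 /\ hdot (T a) (T f) = 0.
  move=> da df Ka Kf.
  have h1 : hdot a f + hdot (T a) (T f) = 0.
    by rewrite -(hdot_hprod (g a) (g f)) -Kf -oproj_adj Ka linear0l.
  have h2 : hdot a f - hdot (T a) (T f) = 0.
    by rewrite -hJ // -Kf -oproj_adj KJ Ka linear0 linear0l.
  have h3 : hdot a f = 0.
    have : hdot a f *+ 2 = 0 by rewrite -[RHS]addr0 -{1}h1 -h2; ring.
    by move/eqP; rewrite mulrn_eq0 /= => /eqP.
  by split => //; move: h1; rewrite h3 add0r.
have P0of f : lop_dom T f -> K (g f) = g f -> P f = 0.
  move=> df Kf; apply: hdot_ext => y; rewrite oproj_adj linear0l.
  have /PA[dy Ky] : P (P y) = P y by rewrite oprojK.
  by rewrite hdotC (orth _ _ dy df Ky Kf).1 rmorph0.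
have Q0of f : lop_dom T f -> K (g f) = 0 -> Q (T f) = 0.
  move=> df Kf; apply: hdot_ext => y; rewrite oproj_adj linear0l.
  have /QD[f' [df' <- Kf']] : Q (Q y) = Q y by rewrite oprojK.
  by rewrite (orth _ _ df df' Kf Kf').2.
(* [f2] is the first component of [K (g f)], which lies on the graph because [K] commutes with
   [E]. *)
have split f : lop_dom T f -> exists f1 f2,
    [/\ f = f1 + f2, lop_dom T f1, lop_dom T f2, K (g f1) = 0 & K (g f2) = g f2].
  move=> df; have /EG[d2 h2] : E (K (g f)) = K (g f) by rewrite KE gG.
  have e2 : K (g f) = g (K (g f)).1 by rewrite /g -h2; case: (K (g f)).
  exists (f - (K (g f)).1), (K (g f)).1.
  have [d1 _] := lopB df d2.
  split=> //; first by rewrite subrK.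
    by rewrite gB // linearB /= -e2 oprojK subrr.
  by rewrite -e2 oprojK.
(* The complement of [D] is taken instead of the image [T A], which may fail to be closed; by [Q0of]
   that image lies in the complement. *)
exists P, (compl_proj Q); split.
- move=> f /split[f1 [f2 [-> d1 d2 K1 K2]]].
  have -> : P (f1 + f2) = f1.
    by rewrite linearD /= (P0of f2) // addr0; apply/PA.
  split => //; rewrite compl_projE (lopD d1 d2).2 linearD /= Q0of // add0r.
  by rewrite [Q _](QD _).1 ?addrK //; exists f2.
- by move=> f /PA[df Kf]; split => //; exact: posT.
- move=> f /split[f1 [f2 [-> d1 d2 K1 K2]]].
  rewrite linearD /= (P0of f2) // addr0 [P f1](PA _).1 // => ->.
  by rewrite add0r; exact: negT.
- move=> h; rewrite compl_projE => /subr0_eq/esym/QD[f [df Tf Kf]].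
  by exists f; split => //; exact: P0of.
Qed.

End ContractionSplitting.

(** * Dual pairs *)

Section Antidual.
Variable R : realType.

Lemma rnorm_gt0 (V : normedZmodType (Cplx R)) (x : V) : x != 0 -> 0 < rnorm x.
Proof.
by move=> x0; rewrite lt_def rnorm_ge0 andbT; apply: contraNneq x0 => /rnorm_eq0 ->.
Qed.

Lemma lip_continuous (V W : normedModType (Cplx R)) (f : V -> W) (c : R) :
  (forall x y, rnorm (f x - f y) <= c * rnorm (x - y)) -> continuous f.
Proof.
move=> fc; apply/continuous_subspace_setT.
by apply: (@within_lip _ _ _ _ f c) => x y _ _; exact: fc.
Qed.

Section Forms.
Variable X : normedModType (Cplx R).
Implicit Type phi : X -> Cplx R.

Definition antilinear phi := forall a u v, phi (a *: u + v) = a^* * phi u + phi v.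

Lemma antilinearB phi u v : antilinear phi -> phi (u - v) = phi u - phi v.
Proof.
by move=> h; rewrite addrC -scaleN1r h rmorphN rmorph1 mulN1r addrC.
Qed.

Lemma antilinear0 phi : antilinear phi -> phi 0 = 0.
Proof. by move=> h; rewrite -(subrr 0) antilinearB // subrr. Qed.

Lemma antilinearZ phi a u : antilinear phi -> phi (a *: u) = a^* * phi u.
Proof. by move=> h; rewrite -[_ *: _]addr0 h antilinear0 // addr0. Qed.

Lemma antilinear_bounded phi (c : R) : antilinear phi ->
  (forall x, rnorm (phi x) <= c * rnorm x) -> antidual X phi.
Proof.
move=> lphi hc; split => //.
apply: (@lip_continuous X (Cplx R)^o phi c) => x y.
by rewrite -[phi x - phi y]antilinearB.
Qed.

Lemma antidual_bounded phi : antidual X phi ->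
  exists2 c : R, 0 < c & forall x, rnorm (phi x) <= c * rnorm x.
Proof.
move=> [lphi cphi].
have /cvgrPdist_lt/(_ 1 ltr01)/nbhs_ballP[_ /= /gt0_complex[d d0 ->] hd] := cphi 0.
exists (2 / d) => [|x]; first by rewrite divr_gt0.
have [->|/rnorm_gt0 x1] := eqVneq x 0; first by rewrite antilinear0 // !rnorm0 mulr0.
(* [t] scales [x] to norm [d / 2], strictly inside the ball where [|phi| < 1]; hence the constant
   [2 / d]. *)
pose t := d / 2 / rnorm x; have t0 : 0 < t by rewrite !divr_gt0.
have : rnorm (phi (t%:C%C *: x)) < 1.
  have := hd (t%:C%C *: x); rewrite antilinear0 // sub0r normrN -ball_normE /=.
  rewrite sub0r normrN -[X in `|phi _| < X]/((1 : R)%:C%C) (rnorm_lt (phi _)); apply.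
  by rewrite rnorm_lt rnormZ rnorm_real gtr0_norm // divfK ?gt_eqF //; lra.
rewrite antilinearZ // rnormM rnorm_conj rnorm_real gtr0_norm //.
rewrite /t mulrAC ltr_pdivrMr // mul1r => h2.
by rewrite mulrAC ler_pdivlMr //; lra.
Qed.

Lemma antidual_norm_bound phi x : antidual X phi ->
  rnorm (phi x) <= antidual_norm phi * rnorm x.
Proof.
move=> aphi; have [lphi _] := aphi; have [c c0 hc] := antidual_bounded aphi.
have [->|/rnorm_gt0 x1] := eqVneq x 0; first by rewrite antilinear0 // !rnorm0 mulr0.
set D := [set complex.Re `|phi y| | y in [set y : X | `|y| <= 1]].
have Dsup : has_sup D.
  split; first by exists (complex.Re `|phi 0|), 0 => //=; rewrite normr0.
  exists c => _ [y /= y1 <-]; apply: le_trans (hc y) _.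
  by rewrite ler_piMr ?(ltW c0) // -rnorm_le.
have h : D (rnorm (phi ((rnorm x)^-1%:C%C *: x))).
  exists ((rnorm x)^-1%:C%C *: x) => //=.
  rewrite -[1]/((1 : R)%:C%C) rnorm_le rnormZ rnorm_real gtr0_norm ?invr_gt0 //.
  by rewrite mulVf // gt_eqF.
have := sup_upper_bound Dsup h; rewrite antilinearZ // rnormM rnorm_conj rnorm_real.
by rewrite gtr0_norm ?invr_gt0 // mulrC ler_pdivrMr.
Qed.

Lemma antidual_norm_le phi (c : R) : 0 <= c ->
  (forall x, rnorm (phi x) <= c * rnorm x) -> antidual_norm phi <= c.
Proof.
move=> c0 hc; apply: ge_sup.
  by exists (complex.Re `|phi 0|), 0 => //=; rewrite normr0.
move=> _ [y /= y1 <-]; apply: le_trans (hc y) _.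
by rewrite ler_piMr // -rnorm_le.
Qed.

Lemma antidual_norm_ge0 phi : antidual X phi -> 0 <= antidual_norm phi.
Proof.
move=> aphi; have [c c0 hc] := antidual_bounded aphi.
apply: le_trans (rnorm_ge0 (phi 0)) _; apply: ub_le_sup; last first.
  by exists 0 => //=; rewrite normr0.
exists c => _ [y /= y1 <-]; apply: le_trans (hc y) _.
by rewrite ler_piMr ?(ltW c0) // -rnorm_le.
Qed.

End Forms.

Section IsometricOnto.
Variables (X Y : normedModType (Cplx R)) (F : Y -> X -> Cplx R).

(** Replaces the supremum norm by pointwise inequalities: [|y|] is the least constant bounding
    [F y], and continuous functionals are the bounded ones. In this form the conditions pass easily
    to subspaces. *)
Lemma isometric_onto_antidualP : isometric_onto_antidual F <->
  [/\ forall y, antilinear (F y),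
      forall y x, rnorm (F y x) <= rnorm y * rnorm x,
      forall y c, 0 <= c -> (forall x, rnorm (F y x) <= c * rnorm x) -> rnorm y <= c,
      forall y z, (forall x, F y x = F z x) -> y = z &
      forall phi c, 0 <= c -> antilinear phi ->
        (forall x, rnorm (phi x) <= c * rnorm x) -> exists y, forall x, F y x = phi x].
Proof.
split=> [[iso [Fa Finj Fsurj]]|[Flin Fle Fmin Finj Fsurj]].
  have Fd y : antidual X (F y) by exact: Fa.
  have Fn y : antidual_norm (F y) = rnorm y by apply: complexI; rewrite iso -rnormE.
  split.
  - by move=> y; case: (Fd y).
  - by move=> y x; rewrite -Fn; exact: antidual_norm_bound.
  - by move=> y c c0 hc; rewrite -Fn; exact: antidual_norm_le.
  - by move=> y z /funext yz; apply: Finj; rewrite ?inE.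
  - move=> phi c _ lphi hc; have [y _ <-] := Fsurj _ (antilinear_bounded lphi hc).
    by exists y.
have Fd y : antidual X (F y) by apply: (antilinear_bounded (Flin y) (Fle y)).
split.
  move=> y; rewrite rnormE; congr (_%:C%C); apply/eqP; rewrite eq_le.
  apply/andP; split; first by apply: antidual_norm_le (Fle y); exact: rnorm_ge0.
  apply: Fmin; first exact: antidual_norm_ge0.
  by move=> x; exact: antidual_norm_bound.
split; first by move=> y _; exact: Fd.
  by move=> y z _ _ yz; apply: Finj => x; rewrite yz.
move=> phi aphi; have [lphi _] := aphi; have [c c0 hc] := antidual_bounded aphi.
have [y hy] := Fsurj _ _ (ltW c0) lphi hc; exists y => //.
exact/funext.
Qed.

End IsometricOnto.
End Antidual.

Section DualProjector.
Variables (R : realType) (X Y : hilbertType R) (F : sesquilinear_form R Y X).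
Hypothesis Fiso : isometric_onto_antidual F.

Lemma rnorm_reflection (P : orthoproj X) x : rnorm (P x - compl_proj P x) = rnorm x.
Proof.
apply/eqP; rewrite -(@eqrXn2 _ 2) ?rnorm_ge0 // -!rdotxx; apply/eqP.
have h : rdot (P x) (compl_proj P x) = 0.
  by rewrite /rdot oproj_adj compl_projE linearB /= oprojK subrr linear0r.
have : x = P x + compl_proj P x by rewrite compl_projE addrC subrK.
move: (compl_proj P x) (P x) h => c p h ->.
by rewrite !(rdotBl, rdotBr, rdotDl, rdotDr) (rdotC c) h; ring.
Qed.

(** [P'] is the adjoint of [P] across the pairing: [F y] composed with [P] is again a bounded
    functional, represented by [P' y]. Idempotence is inherited by duality; orthogonality in [Y] has
    to be drawn from the isometry of the pairing. *)
Lemma dual_projector (P : orthoproj X) :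
  exists P' : orthoproj Y, forall y x, F (P' y) x = F y (P x).
Proof.
have [Flin Fle Fmin Finj Fsurj] := (isometric_onto_antidualP _).1 Fiso.
have /choice[p hp] y : exists z, forall x, F z x = F y (P x).
  apply: (Fsurj (fun x => F y (P x)) (rnorm y) (rnorm_ge0 _)) => [a u v|x].
    by rewrite linearP Flin.
  by apply: le_trans (Fle _ _) _; apply: ler_wpM2l; rewrite ?rnorm_ge0 ?rnorm_proj.
have FD x y z : F (y + z) x = F y x + F z x by exact: linearDl.
have FB x y z : F (y - z) x = F y x - F z x by exact: linearBl.
have FZ a x y : F (a *: y) x = a * F y x by exact: linearZl_LR.
have linp : linear p.
  by move=> a u v; apply: Finj => x; rewrite hp !FD !FZ !hp.
have [L LE] := bundle_linear linp.
have hL y x : F (L y) x = F y (P x) by rewrite LE hp.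
have LK y : L (L y) = L y by apply: Finj => x; rewrite !hL oprojK.
(* On [y1 + y2] and [y1 - y2] the form differs by the reflection [2 P - 1] of its
   right argument, which is isometric: hence both have the same norm. *)
have half y1 y2 : L y1 = y1 -> L y2 = 0 -> 0 <= rdot y1 y2.
  move=> Ly1 Ly2.
  have F1 x : F y1 (compl_proj P x) = 0.
    by rewrite -Ly1 hL compl_projE linearB /= oprojK subrr antilinear0.
  have F2 x : F y2 (P x) = 0 by rewrite -hL Ly2 linear0l.
  have h x : F (y1 - y2) x = F (y1 + y2) (P x - compl_proj P x).
    have FBr y u v : F y (u - v) = F y u - F y v by exact: antilinearB.
    have e : F y2 (compl_proj P x) = F y2 x by rewrite compl_projE FBr F2 subr0.
    rewrite FB FD !(FBr _ (P x) (compl_proj P x)) F1 F2 e subr0 sub0r.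
    by rewrite -hL Ly1.
  have : rnorm (y1 - y2) <= rnorm (y1 + y2).
    apply: Fmin; first exact: rnorm_ge0.
    by move=> x; rewrite h -(rnorm_reflection P x); exact: Fle.
  rewrite -ler_sqr ?nnegrE ?rnorm_ge0 // -!rdotxx.
  rewrite !(rdotBl, rdotBr, rdotDl, rdotDr) (rdotC y2 y1); lra.
(* [half] applied to [L (a *: y)] and to its negative makes the real part vanish for every [a]. *)
have orth y z : hdot (L y) (z - L z) = 0.
  apply: hdot_eq0 => a; rewrite -linearZ_LR.
  have h1 : 0 <= rdot (L (a *: y)) (z - L z).
    by apply: half; rewrite ?LK // linearB /= LK subrr.
  have h2 : 0 <= rdot (L (- (a *: y))) (z - L z).
    by apply: half; rewrite ?LK // linearB /= LK subrr.
  by apply/eqP; rewrite eq_le h1 andbT -oppr_ge0 -rdotNl -(linearN L).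
have Ladj y z : hdot (L y) z = hdot y (L z).
  have e u v : hdot (L u) v = hdot (L u) (L v).
    by apply/subr0_eq; rewrite -hdotBr orth.
  by rewrite e [RHS]hdotC [in RHS]e -hdotC.
by exists (OrthoProj LK Ladj) => y x; exact: hL.
Qed.

End DualProjector.

Section RestrictedPair.
Variables (R : realType) (X Y : hilbertType R).
Variables (P : orthoproj X) (Q : orthoproj Y).

(** Adjointness makes [F y], for [y] in the range of [Q], depend on [P x] only, so bounds over the
    subspace are bounds over [X]; a functional on the subspace is represented after composing it
    with [P]. *)
Lemma isometric_onto_restrict (F : Y -> X -> Cplx R) :
  (forall y x, F (Q y) x = F y (P x)) -> isometric_onto_antidual F ->
  isometric_onto_antidual (fun (y : prange Q) (x : prange P) => F (prval y) (prval x)).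
Proof.
move=> QP /isometric_onto_antidualP[Flin Fle Fmin Finj Fsurj].
have FP (y : prange Q) x : F (prval y) x = F (prval y) (P x).
  by rewrite -QP prval_fix.
apply/isometric_onto_antidualP; split.
- by move=> y a u v; rewrite linearP Flin.
- by move=> y x; rewrite !rnorm_prange.
- move=> y c c0 hc; rewrite rnorm_prange; apply: Fmin => // x.
  rewrite FP; have := hc (prproj P x); rewrite rnorm_prange /= => /le_trans; apply.
  by apply: ler_wpM2l => //; exact: rnorm_proj.
- move=> y z yz; apply: val_inj; apply: Finj => x.
  by rewrite FP [RHS]FP; exact: (yz (prproj P x)).
- move=> phi c c0 lphi hc.
  have [a u v|x|y hy] := Fsurj (fun x => phi (prproj P x)) c c0.
  + rewrite -lphi; congr phi; apply: val_inj => /=.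
    by rewrite linearP.
  + apply: le_trans (hc _) _; rewrite rnorm_prange /=.
    by apply: ler_wpM2l => //; exact: rnorm_proj.
  + exists (prproj Q y) => x; rewrite /= QP prval_fix hy; congr phi.
    exact: prprojK.
Qed.

Lemma prval_continuous : continuous (@prval R X P).
Proof.
apply: (@lip_continuous _ _ _ (@prval R X P) 1) => x y.
by rewrite mul1r -linearB rnorm_prange.
Qed.

End RestrictedPair.

(** * Restriction of operators and triples *)

Section RestrictedOperator.
Variables (R : realType) (X X0 : hilbertType R) (T : linear_operator X X0).
Variables (P : orthoproj X) (P0 : orthoproj X0).

(** The inclusion of [P0 T] in [T P] as unbounded operators: the ranges of [P] and [P0] reduce
    [T]. *)
Definition reduces := forall f, lop_dom T f -> lop_dom T (P f) /\ T (P f) = P0 (T f).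

Definition restr_dom : set (prange P) := [set x | lop_dom T (prval x)].
(** Applying [P0] gives the value the right type; on the domain of a reduced operator it changes
    nothing ([restr_opE]). *)
Definition restr_fun (x : prange P) : prange P0 := prproj P0 (T (prval x)).

Fact restr_linear a u v : restr_dom u -> restr_dom v ->
  restr_fun (a *: u + v) = a *: restr_fun u + restr_fun v.
Proof.
by move=> du dv; apply: val_inj; rewrite /= lop_linear // linearP.
Qed.

Definition restr_op : linear_operator (prange P) (prange P0) :=
  @LinearOperator _ _ _ restr_dom restr_fun (lop_dom0 T)
    (fun a u v du dv => lop_domP a du dv) restr_linear.

Hypothesis red : reduces.

Lemma restr_opE (x : prange P) : restr_dom x -> prval (restr_op x) = T (prval x).
Proof. by move=> dx; rewrite /= -(red dx).2 prval_fix. Qed.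

Lemma restr_op_restricts : restricts_to (@prval R X P) (@prval R X0 P0) T restr_op.
Proof. by split=> // x dx; rewrite restr_opE. Qed.

Lemma prproj_dense (A : set X) : dense A -> (forall x, A x -> A (P x)) ->
  dense [set x : prange P | A (prval x)].
Proof.
move=> dA AP; apply: dense_tends => x e e0.
have [u Au ux] := tends_dense (prval x) dA.
have [N /(_ _ (leqnn N)) h] := tends_proj P ux e0.
exists (prproj P (u N)); first exact: AP.
by rewrite rnorm_prange /=; move: h; rewrite prval_fix.
Qed.

Lemma reduces_compl : forall f, lop_dom T f ->
  lop_dom T (compl_proj P f) /\ T (compl_proj P f) = compl_proj P0 (T f).
Proof.
move=> f df; have [dPf TPf] := red df; rewrite !compl_projE -TPf.
exact: lopB.
Qed.

(** The new graph is the preimage of the old one under the continuous inclusions. Density follows by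
    projecting approximating sequences, which stay in the domain or range. *)
Lemma restr_op_embedding : embedding_operator T -> embedding_operator restr_op.
Proof.
move=> [dT cT iT rT]; split.
- by apply: prproj_dense => // f df; case: (red df).
- rewrite /closed_operator; have -> : [set p : prange P * prange P0 | lop_dom restr_op p.1 /\ p.2 = restr_op p.1] =
    (fun p => (prval p.1, prval p.2)) @^-1` [set p | lop_dom T p.1 /\ p.2 = T p.1].
    apply/seteqP; split => -[x y] /= [dx h]; split => //.
      by rewrite h; exact: restr_opE.
    by apply: val_inj; transitivity (T (prval x)) => //; exact/esym/restr_opE.
  apply: preimage_closed cT => p _.
  apply: cvg_pair => /=.
    by apply: cvg_comp; [exact: cvg_fst|exact: prval_continuous].
  by apply: cvg_comp; [exact: cvg_snd|exact: prval_continuous].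
- move=> x y; rewrite !inE => dx dy /(congr1 (@prval R X0 P0)).
  by rewrite !restr_opE // => h; apply: val_inj; apply: iT; rewrite ?inE.
- have -> : lop_ran restr_op = [set h | lop_ran T (prval h)].
    apply/seteqP; split => h /=.
      by move=> [x dx <-]; exists (prval x) => //; rewrite restr_opE.
    move=> [f df Tf]; have [dPf TPf] := red df.
    by exists (prproj P f) => //; apply: val_inj; rewrite /= TPf Tf !prval_fix.
  apply: (@dense_tends _ (prange P0)) => x e e0.
  have [u Au ux] := tends_dense (prval x) rT.
  have [N /(_ _ (leqnn N)) h] := tends_proj P0 ux e0.
  exists (prproj P0 (u N)).
    by have [f df Tf] := Au N; have [dPf TPf] := red df; exists (P f); rewrite //= TPf Tf.
  by rewrite rnorm_prange /=; move: h; rewrite prval_fix.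
Qed.

End RestrictedOperator.

(** * Pre-quasi Gelfand triples on the ranges of adjoint projectors *)

Section RestrictedTriple.
Variables (R : realType) (Xp X0 Xm : hilbertType R).
Variable T : pre_quasi_gelfand_triple Xp X0 Xm.
Variables (P : orthoproj Xp) (P0 : orthoproj X0) (P' : orthoproj Xm).

Definition restr_form (g : prange P') (f : prange P) : Cplx R :=
  pairing T (prval g) (prval f).

Fact restr_form_bilinear : bilinear_for *%R (@Num.conj (Cplx R) \; *%R) restr_form.
Proof.
split=> z a x y; first exact: (linearPl (pairing T)).
exact: (linearPr (pairing T)).
Qed.

HB.instance Definition _ :=
  bilinear_isBilinear.Build _ _ _ _ _ _ restr_form restr_form_bilinear.

Hypothesis PP' : forall g f, pairing T (P' g) f = pairing T g (P f).
Hypothesis redp : reduces (iotap T) P P0.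
Hypothesis redm : reduces (iotam T) P' P0.

Lemma restr_form_dual : complete_dual_pair (restr_form : sesquilinear_form R _ _).
Proof.
have [c i1 i2] := pairing_dual T; split.
- move=> p; apply: (@cvg_comp _ _ _ (fun p : prange P' * prange P => (prval p.1, prval p.2))
    (fun p => pairing T p.1 p.2) _ _ _ _ (c (prval p.1, prval p.2))).
  by apply: cvg_pair => /=;
    (apply: cvg_comp; [exact: cvg_fst || exact: cvg_snd|exact: prval_continuous]).
- exact: isometric_onto_restrict i1.
- apply: isometric_onto_restrict i2 => f g; by rewrite PP'.
Qed.

Fact restr_pairing_iota f g :
  lop_dom (restr_op (iotap T) P P0) f -> lop_dom (restr_op (iotam T) P' P0) g ->
  restr_form g f = hdot (restr_op (iotam T) P' P0 g) (restr_op (iotap T) P P0 f).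
Proof.
move=> df dg; rewrite hdot_prange !restr_opE //.
exact: pairing_iota.
Qed.

Definition restr_triple :=
  PreQuasiGelfandTriple restr_form_dual
    (restr_op_embedding redp (iotap_embedding T))
    (restr_op_embedding redm (iotam_embedding T)) restr_pairing_iota.

End RestrictedTriple.

(** * Exchanging the two outer spaces of a triple *)

Section FlippedTriple.
Variables (R : realType) (Xp X0 Xm : hilbertType R).
Variable T : pre_quasi_gelfand_triple Xp X0 Xm.

Definition flip_form (f : Xp) (g : Xm) : Cplx R := (pairing T g f)^*.

Fact flip_form_bilinear : bilinear_for *%R (@Num.conj (Cplx R) \; *%R) flip_form.
Proof.
split=> z a x y; rewrite /flip_form.
  by rewrite [pairing T _ _](linearPr (pairing T)) /= rmorphD rmorphM /= conjCK.
by rewrite [pairing T _ _](linearPl (pairing T)) /= rmorphD rmorphM.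
Qed.

HB.instance Definition _ :=
  bilinear_isBilinear.Build _ _ _ _ _ _ flip_form flip_form_bilinear.

Lemma conj_continuous : continuous (fun a : Cplx R => a^*).
Proof.
apply: (@lip_continuous _ (Cplx R)^o (Cplx R)^o (fun a => a^*) 1) => x y.
by rewrite mul1r -rmorphB; rewrite (rnorm_conj (x - y)).
Qed.

Lemma flip_form_dual : complete_dual_pair (flip_form : sesquilinear_form R _ _).
Proof.
have [c i1 i2] := pairing_dual T; split => //.
- move=> p; apply: (@cvg_comp _ _ _ (fun p : Xp * Xm => pairing T p.2 p.1)
    (fun a : Cplx R => a^*)); last exact: conj_continuous.
  apply: (@cvg_comp _ _ _ (fun p : Xp * Xm => (p.2, p.1))
    (fun p => pairing T p.1 p.2) _ _ _ _ (c (p.2, p.1))).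
  by apply: cvg_pair => /=; [exact: cvg_snd|exact: cvg_fst].
- suff -> : (fun (x : Xm) (y : Xp) => (flip_form y x)^*) = pairing T by [].
  by apply/funext => g; apply/funext => f; rewrite /flip_form conjCK.
Qed.

Fact flip_pairing_iota g f : lop_dom (iotam T) g -> lop_dom (iotap T) f ->
  flip_form f g = hdot (iotap T f) (iotam T g).
Proof. by move=> dg df; rewrite /flip_form pairing_iota // -hdotC. Qed.

(** On the part where [iota_+] is expansive it is [iota_-] that is continuous, so the second triple
    is cut out of this one, with [Xm] in the first place. *)
Definition flip_triple : pre_quasi_gelfand_triple Xm X0 Xp :=
  PreQuasiGelfandTriple flip_form_dual (iotam_embedding T) (iotap_embedding T)
    flip_pairing_iota.

End FlippedTriple.

Lemma orthogonal_sum_proj (R : realType) (X : hilbertType R) (P : orthoproj X) :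
  orthogonal_sum (@prval R X P) (@prval R X (compl_proj P)).
Proof.
split=> //.
- move=> y z /=; rewrite -(prval_fix y) oproj_adj -(prval_fix z) compl_projE.
  by rewrite linearB /= oprojK subrr linear0r.
- move=> x; exists (prproj P x), (prproj (compl_proj P) x) => /=.
  by rewrite addrC subrK.
Qed.

(** * Quasi Gelfand triples and their reduction by projectors *)

Section QuasiGelfand.
Variables (R : realType) (Xp X0 Xm : hilbertType R).
Variable T : pre_quasi_gelfand_triple Xp X0 Xm.

Lemma rnorm_pairing g f : rnorm (pairing T g f) <= rnorm g * rnorm f.
Proof.
have [_ /isometric_onto_antidualP[_ h _ _ _] _] := pairing_dual T.
exact: h.
Qed.

Lemma adjoint_dom_bounded (h : X0) (c : R) :
  (forall f, lop_dom (iotap T) f -> rnorm (hdot h (iotap T f)) <= c * rnorm f) ->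
  adjoint_dom (iotap T) h.
Proof.
move=> hc; apply: (@within_lip _ _ (Cplx R)^o _ _ c) => x y dx dy.
have [dxy Txy] := lopB dx dy.
by rewrite -[_ - _]hdotBr -Txy; exact: hc.
Qed.

(** By [|<g, f>| <= |g| |f|] this inclusion holds in every pre-quasi Gelfand triple; for the two
    parts only the converse is left to prove. *)
Lemma ran_adjoint_dom : lop_ran (iotam T) `<=` adjoint_dom (iotap T).
Proof.
move=> _ [g dg <-]; apply: (@adjoint_dom_bounded _ (rnorm g)) => f df.
by rewrite -pairing_iota //; exact: rnorm_pairing.
Qed.

Lemma iotap_continuous :
  (forall f, lop_dom (iotap T) f -> rnorm (iotap T f) <= rnorm f) ->
  {within lop_dom (iotap T), continuous (iotap T)}.
Proof.
move=> h; apply: (@within_lip _ _ _ _ _ 1) => x y dx dy.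
by rewrite -(lopB dx dy).2 mul1r; apply: h; exact: (lopB dx dy).1.
Qed.

Lemma pairing_dense_eq g g' :
  (forall f, lop_dom (iotap T) f -> pairing T g f = pairing T g' f) -> g = g'.
Proof.
move=> gg'; have [_ /isometric_onto_antidualP[Flin Fle _ Finj _] _] := pairing_dual T.
apply: Finj => f; have [dT _ _ _] := iotap_embedding T.
have [u du uf] := tends_dense f dT.
have cvg z : tends (fun n => pairing T z (u n)) (pairing T z f).
  apply: (@tends_lip _ _ _ (pairing T z) (rnorm z)) => // x y.
  by rewrite -antilinearB.
apply: (tends_unique (cvg g)).
by apply: tends_ext (cvg g') => n; rewrite gg'.
Qed.

Hypothesis qT : quasi_gelfand_triple T.
Variables (P : orthoproj Xp) (P0 : orthoproj X0) (P' : orthoproj Xm).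
Hypothesis PP' : forall g f, pairing T (P' g) f = pairing T g (P f).

(** The functional of [P0 (iota_- g)] is [f |-> <g, P f>], bounded by [|g| |f|]. The quasi Gelfand
    property writes [P0 (iota_- g)] as [iota_- g'], and [g' = P' g] because both pair equally with
    the dense [dom iota_+]. *)
Lemma reduces_dual : reduces (iotap T) P P0 -> reduces (iotam T) P' P0.
Proof.
move=> red g dg.
have : adjoint_dom (iotap T) (P0 (iotam T g)).
  apply: (@adjoint_dom_bounded _ (rnorm g)) => f df.
  have [dPf TPf] := red f df.
  rewrite oproj_adj -TPf -pairing_iota //.
  apply: le_trans (rnorm_pairing _ _) _.
  by apply: ler_wpM2l; [exact: rnorm_ge0|exact: rnorm_proj].
rewrite qT => -[g' dg' hg'].
suff <- : g' = P' g by [].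
apply: pairing_dense_eq => f df; have [dPf TPf] := red f df.
by rewrite PP' !pairing_iota // hg' oproj_adj TPf.
Qed.

End QuasiGelfand.

(** * The two ordinary triples and the orthogonal decomposition *)

Theorem theorem6p6 (R : realType) (Xp X0 Xm : hilbertType R)
    (T : pre_quasi_gelfand_triple Xp X0 Xm) (qT : quasi_gelfand_triple T) :
  exists (Xp1 X01 Xm1 : hilbertType R)
         (T1 : pre_quasi_gelfand_triple Xp1 X01 Xm1)
         (Xp2 X02 Xm2 : hilbertType R)
         (T2 : pre_quasi_gelfand_triple Xp2 X02 Xm2),
    gelfand_triple T1 /\ gelfand_triple T2 /\
    exists (jp1 : {linear Xp1 -> Xp}) (jm2 : {linear Xm2 -> Xp})
           (j01 : {linear X01 -> X0}) (j02 : {linear X02 -> X0})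
           (jm1 : {linear Xm1 -> Xm}) (jp2 : {linear Xp2 -> Xm}),
      [/\ orthogonal_sum jp1 jm2,
          orthogonal_sum j01 j02 &
          orthogonal_sum jm1 jp2] /\
      [/\ restricts_to jp1 j01 (iotap T) (iotap T1),
          restricts_to jm2 j02 (iotap T) (iotam T2),
          restricts_to jm1 j01 (iotam T) (iotam T1) &
          restricts_to jp2 j02 (iotam T) (iotap T2)].
Proof.
have [_ iso _] := pairing_dual T.
have [_ clp injp _] := iotap_embedding T; have [_ _ injm _] := iotam_embedding T.
have [P [P0 [redp contrp expp surjp]]] := contraction_splitting clp.
have [P' PP'] := dual_projector iso P.
have redm := reduces_dual qT PP' redp.
have redpc := reduces_compl redp; have redmc := reduces_compl redm.
have PPc f g : pairing (flip_triple T) (compl_proj P f) g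
             = pairing (flip_triple T) f (compl_proj P' g).
  rewrite /= /flip_form !compl_projE; congr (_^*).
  by rewrite linearBr linearBl /= PP'.
(* [T1] lives on the ranges of [P], [P0] and [P']; [T2] lives on their complements and is cut from
   the flipped triple, so that its first space lies in [Xm]. *)
pose T1 := restr_triple PP' redp redm.
pose T2 := @restr_triple _ _ _ _ (flip_triple T) _ _ _ PPc redmc redpc.
have q1 : quasi_gelfand_triple T1.
  apply/seteqP; split; last exact: ran_adjoint_dom.
  move=> h _.
  (* Every [h] in the range of [P0] qualifies: against it [iota_+ f] may be replaced by
     [iota_+ (P f)], of norm at most [|f|]. So [iota_-] of [T1] is onto. *)
  have : adjoint_dom (iotap T) (prval h).
    apply: (@adjoint_dom_bounded _ _ _ _ _ _ (rnorm h)) => f df.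
    have [dPf TPf] := redp f df.
    rewrite -(prval_fix h) oproj_adj -TPf.
    apply: le_trans (hdot_cauchy _ _) _; rewrite rnorm_prange.
    apply: ler_wpM2l; first exact: rnorm_ge0.
    have [_ le] := contrp _ (oprojK P f).
    by apply: le_trans le _; exact: rnorm_proj.
  rewrite qT => -[g dg hg]; have [dPg TPg] := redm g dg.
  exists (prproj P' g) => //; apply: val_inj => /=.
  by rewrite TPg hg !prval_fix.
have q2 : quasi_gelfand_triple T2.
  apply/seteqP; split; last exact: ran_adjoint_dom.
  (* The second embedding of [T2] is a restriction of [iota_+], and it is onto: [surjp] yields a
     preimage of [h] in the kernel of [P]. *)
  move=> h _; have /surjp[f [df Pf Tf]] : P0 (prval h) = 0.
    by apply/compl_proj_fix; exact: prval_fix.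
  exists (prproj (compl_proj P) f); first by rewrite /= /restr_dom /=; exact: (redpc f df).1.
  apply: val_inj; transitivity (compl_proj P0 (compl_proj P0 (prval h))).
    by rewrite -Tf -(redpc f df).2.
  by rewrite !prval_fix.
have c1 : gelfand_triple T1.
  split=> //; apply: iotap_continuous => f df.
  rewrite !rnorm_prange restr_opE //.
  exact: (contrp _ (prval_fix f)).2.
have c2 : gelfand_triple T2.
  split=> //; apply: iotap_continuous => g dg.
  rewrite !rnorm_prange restr_opE //.
  have P'g : P' (prval g) = 0 by apply/compl_proj_fix; exact: prval_fix.
  (* With [iota_+ f = iota_- g] and [|f| <= |iota_+ f|], one gets [|iota_- g|^2 = |<g, f>| <= |g|
     |f| <= |g| |iota_- g|]. *)
  have /surjp[f [df Pf Tf]] : P0 (iotam T (prval g)) = 0.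
    rewrite -(redm _ dg).2 P'g.
    by have [_] := lopB (lop_dom0 (iotam T)) (lop_dom0 (iotam T)); rewrite !subrr.
  have le1 := expp f df Pf; rewrite Tf in le1.
  have le2 := rnorm_pairing T (prval g) f.
  have e : rnorm (iotam T (prval g)) ^+ 2 = rnorm (pairing T (prval g) f).
    rewrite pairing_iota // Tf; apply: complexI.
    by rewrite -rnormE hdotxx normrX normr_id rmorphXn /= -rnormE.
  have := rnorm_ge0 (prval g); have := rnorm_ge0 f.
  have := rnorm_ge0 (iotam T (prval g)); nra.
exists (prange P), (prange P0), (prange P'), T1.
exists (prange (compl_proj P')), (prange (compl_proj P0)), (prange (compl_proj P)), T2.
split=> //; split=> //.
exists (@prval _ _ P), (@prval _ _ (compl_proj P)), (@prval _ _ P0), (@prval _ _ (compl_proj P0)),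
  (@prval _ _ P'), (@prval _ _ (compl_proj P')).
by split; split; (exact: orthogonal_sum_proj || exact: restr_op_restricts).
Qed.
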